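(* Let $E_1,E_2$ be (real) Banach lattices whose duals $E_1^*$, $E_2^*$ have order continuous norms. Then, for every positive almost Dunford-Pettis bilinear form $A\colon E_1\times E_2\longrightarrow\mathbb{R}$, both Aron-Berner extensions $AB_2^\rho(A)\colon E_1^{**}\times E_2^{**}\longrightarrow\mathbb{R}$, $\rho\in S_2$, are weakly positively limited, hence almost Dunford-Pettis.
   Context: A sequence $(x_n)$ in a Banach lattice is disjoint if $|x_n|\wedge|x_k|=0$ for $n\ne k$. A bilinear operator between Banach lattices is positive if it maps pairs of positive elements to positive elements. For Banach lattices $E_1,\ldots,E_m$ and a Banach space $G$, an $m$-linear operator $A\colon E_1\times\cdots\times E_m\to G$ is almost Dunford-Pettis if $(A(x_{1,n},\ldots,x_{m,n}))_{n=1}^\infty$ is norm null in $G$ whenever $(x_{j,n})_{n=1}^\infty$ is a disjoint weakly null sequence in $E_j$, $j=1,\ldots,m$. For Banach lattices $X_1,\ldots,X_m$ and a Banach space $G$, an $m$-linear operator $B\colon X_1^*\times\cdots\times X_m^*\to G$ is weakly positively limited if, for every $j\in\{1,\ldots,m\}$, the sequence $(B(x_{1,n}^*,\ldots,x_{m,n}^* ))_{n=1}^\infty$ is norm null in $G$ whenever $(x_{j,n}^* )_{n=1}^\infty$ is a positive weak$^*$-null sequence in $X_j^*$ and $(x_{i,n}^* )_{n=1}^\infty$ is a positive bounded sequence in $X_i^*$ for each $i\neq j$. Here this is applied with $X_i=E_i^*$, so the weak$^*$ topology on $E_i^{**}$ is $\sigma(E_i^{**},E_i^* )$. Aron-Berner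 extensions of a continuous bilinear form $A$ on $E_1\times E_2$: for $\rho=\mathrm{id}$, $AB_2^{\mathrm{id}}(A)(x^{**},y^{**})=y^{**}\big(y\mapsto x^{**}(A(\bullet,y))\big)$; for $\rho=\theta$ the transposition, $AB_2^{\theta}(A)(x^{**},y^{**})=x^{**}\big(x\mapsto y^{**}(A(x,\bullet))\big)$, where $A(\bullet,y)\in E_1^*$ and $A(x,\bullet)\in E_2^*$ are the functionals $x\mapsto A(x,y)$ and $y\mapsto A(x,y)$. *)

(* Defs.v *)
From HB Require Import structures.
From mathcomp Require Import all_boot all_order all_algebra all_fingroup.
From mathcomp Require Import all_classical all_reals all_analysis.
From mathcomp Require Import lra.

Set Implicit Arguments.
Unset Strict Implicit.
Unset Printing Implicit Defensive.

Import Order.TTheory GRing.Theory Num.Theory.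
Import numFieldNormedType.Exports.

Local Open Scope classical_set_scope.
Local Open Scope ring_scope.

HB.mixin Record isBanachLattice (R : realType) E & CompleteNormedModule R E := {
  bl_le : rel E ;
  bl_meet : E -> E -> E ;
  bl_join : E -> E -> E ;
  bl_le_refl : reflexive bl_le ;
  bl_le_anti : antisymmetric bl_le ;
  bl_le_trans : transitive bl_le ;
  bl_meetP : forall x y z, bl_le x (bl_meet y z) = bl_le x y && bl_le x z ;
  bl_joinP : forall x y z, bl_le (bl_join x y) z = bl_le x z && bl_le y z ;
  bl_leD : forall z x y : E, bl_le x y -> bl_le (x + z) (y + z) ;
  bl_leZ : forall (a : R) (x y : E), 0 <= a -> bl_le x y ->
    bl_le (a *: x) (a *: y) ;
  (* join x (- x) is the modulus of x *)
  bl_norm_le : forall x y : E,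
    bl_le (bl_join x (- x)) (bl_join y (- y)) -> `|x| <= `|y|
}.

#[short(type="banachLatticeType")]
HB.structure Definition BanachLattice (R : realType) :=
  {E of CompleteNormedModule R E & isBanachLattice R E}.

(* The order is a field of the mixin because Hierarchy Builder has no join of
   Order.Lattice and NormedModule; these instances make the generic order
   notations and lemmas available on every banachLatticeType. *)
#[non_forgetful_inheritance]
HB.instance Definition _ (R : realType) (E : banachLatticeType R) :=
  Order.Le_isPOrder.Build ring_display E
    (@bl_le_refl _ E) (@bl_le_anti _ E) (@bl_le_trans _ E).
#[non_forgetful_inheritance]
HB.instance Definition _ (R : realType) (E : banachLatticeType R) :=
  Order.POrder_MeetJoin_isLattice.Build ring_display E
    (@bl_meetP _ E) (@bl_joinP _ E).

Section BanachLatticeTheory.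
Context {R : realType} {E : banachLatticeType R}.
Implicit Types x y z : E.

Definition labs x : E := Order.join x (- x).
Definition lpos x : E := Order.join x (0 : E).
Definition lneg x : E := lpos (- x).

Lemma bl_norm_mono x y : labs x <= labs y -> `|x| <= `|y|.
Proof. exact: bl_norm_le. Qed.

Lemma bl_leZ2l (a : R) x y : 0 <= a -> x <= y -> a *: x <= a *: y.
Proof. exact: bl_leZ. Qed.

Lemma bl_lerD2r z x y : (x + z <= y + z) = (x <= y).
Proof.
apply/idP/idP => [h|]; last exact: bl_leD.
by rewrite -(addrK z x) -(addrK z y); apply: bl_leD.
Qed.

Lemma bl_lerD2l z x y : (z + x <= z + y) = (x <= y).
Proof. by rewrite ![z + _]addrC bl_lerD2r. Qed.

Lemma bl_lerD x y z t : x <= y -> z <= t -> x + z <= y + t.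
Proof.
by move=> xy zt; apply: (@le_trans _ _ (y + z));
  rewrite ?bl_lerD2r ?bl_lerD2l.
Qed.

Lemma bl_subr_ge0 x y : (0 <= y - x) = (x <= y).
Proof. by rewrite -(bl_lerD2r x 0) add0r subrK. Qed.

Lemma bl_lerBlDr x y z : (x - y <= z) = (x <= z + y).
Proof. by rewrite -(bl_lerD2r y (x - y)) subrK. Qed.

Lemma bl_lerBrDr x y z : (x <= y - z) = (x + z <= y).
Proof. by rewrite -(bl_lerD2r z x) subrK. Qed.

Lemma bl_lerN2 x y : (- x <= - y) = (y <= x).
Proof. by rewrite -(bl_subr_ge0 (- x) (- y)) opprK addrC bl_subr_ge0. Qed.

Lemma bl_addr_ge0 x y : 0 <= x -> 0 <= y -> 0 <= x + y.
Proof. by move=> x0 y0; rewrite -[0]addr0 bl_lerD. Qed.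

Lemma bl_scale_ge0 (a : R) x : 0 <= a -> 0 <= x -> 0 <= a *: x.
Proof. by move=> a0 /(bl_leZ2l a0); rewrite scaler0. Qed.

Lemma bl_joinDr x y z : Order.join x y + z = Order.join (x + z) (y + z).
Proof.
apply/le_anti/andP; split; last by rewrite leUx !bl_lerD2r leUl leUr.
by rewrite -bl_lerBrDr leUx !bl_lerBrDr leUl leUr.
Qed.

Lemma lpos_ge0 x : 0 <= lpos x. Proof. exact: leUr. Qed.

Lemma lneg_ge0 x : 0 <= lneg x. Proof. exact: leUr. Qed.

Lemma lposBneg x : x = lpos x - lneg x.
Proof.
apply/esym/eqP; rewrite subr_eq; apply/eqP.
by rewrite addrC /lneg /lpos bl_joinDr addNr add0r joinC.
Qed.

Lemma le_labs x : x <= labs x. Proof. exact: leUl. Qed.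

Lemma leN_labs x : - x <= labs x. Proof. exact: leUr. Qed.

Lemma labs_le x y : (labs x <= y) = (x <= y) && (- x <= y).
Proof. exact: leUx. Qed.

Lemma labs_ge0 x : 0 <= labs x.
Proof.
have h : 0 <= labs x + labs x.
  by rewrite -(subrr x) bl_lerD// ?le_labs ?leN_labs.
have := @bl_scale_ge0 2^-1 _ _ h; rewrite invr_ge0 ler0n => /(_ isT).
by rewrite scalerDr -scalerDl -mulr2n -[_ *+ 2]mulr_natr mulVf ?scale1r.
Qed.

Lemma ge0_labs x : 0 <= x -> labs x = x.
Proof.
move=> x0; apply/le_anti; rewrite le_labs andbT labs_le lexx /=.
by apply: (@le_trans _ _ 0) => //; rewrite -[leRHS]oppr0 bl_lerN2.
Qed.

Lemma norm_labs x : `|labs x| = `|x|.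
Proof.
by apply/le_anti; rewrite !bl_norm_mono// (ge0_labs (labs_ge0 x)).
Qed.

Lemma bl_ge0_norm_le x y : 0 <= x -> x <= y -> `|x| <= `|y|.
Proof.
move=> x0 xy; apply: bl_norm_mono.
by rewrite !ge0_labs// (le_trans x0).
Qed.

Lemma bl_norm_le_between x y : - y <= x -> x <= y -> `|x| <= `|y|.
Proof.
move=> yx xy; have xy' : labs x <= y by rewrite labs_le xy -bl_lerN2 opprK.
apply: bl_norm_mono; rewrite (le_trans xy')// le_labs//.
Qed.

Lemma norm_lpos_le x : `|lpos x| <= `|x|.
Proof.
rewrite -[leRHS]norm_labs; apply: bl_ge0_norm_le; first exact: lpos_ge0.
by rewrite leUx le_labs labs_ge0.
Qed.

Lemma norm_lneg_le x : `|lneg x| <= `|x|.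
Proof. by rewrite -[leRHS]normrN norm_lpos_le. Qed.

(* Riesz decomposition property *)
Lemma riesz_decomposition x y z : 0 <= x -> 0 <= y -> 0 <= z -> z <= x + y ->
  exists2 u, 0 <= u <= x & 0 <= z - u <= y.
Proof.
move=> x0 y0 z0 zxy; exists (Order.meet z x).
  by rewrite lexI z0 x0 leIr.
rewrite bl_subr_ge0 leIl /= bl_lerBlDr addrC -bl_lerBlDr lexI.
by rewrite !bl_lerBlDr zxy andbT -[X in X <= _]addr0 bl_lerD2l.
Qed.

End BanachLatticeTheory.

Section TopologicalDual.
Context {R : realType} {E : normedModType R}.

Definition dual_pred : {pred E -> R^o} :=
  [pred f | `[< linear f /\ continuous f >]].

Lemma dual_submod_closed : submod_closed dual_pred.
Proof.
split=> [|a f g /asboolP[lf cf] /asboolP[lg cg]]; apply/asboolP; split.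
- by move=> a x y; rewrite /= scaler0 addr0.
- by move=> x; exact: cvg_cst.
- move=> b x y; rewrite !fctE lf lg !scalerDr -!addrA; congr (_ + _).
    by rewrite !scalerA mulrC.
  by rewrite addrCA.
- move=> x; apply: cvgD; last exact: cg.
  by apply: cvgZr; exact: cf.
Qed.

HB.instance Definition _ :=
  GRing.isSubmodClosed.Build R (E -> R^o) dual_pred dual_submod_closed.

End TopologicalDual.
Arguments dual_pred {R} E.

Record dual (R : realType) (E : normedModType R) :=
  Dual { dual_fun :> E -> R^o ; dual_funP : dual_fun \in dual_pred E }.
Arguments dual_fun {R E}.

Section DualModule.
Context {R : realType} {E : normedModType R}.

HB.instance Definition _ := [isSub for @dual_fun R E].
HB.instance Definition _ := [Choice of dual E by <:].
HB.instance Definition _ := [SubChoice_isSubLmodule of dual E by <:].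

End DualModule.

Section DualNorm.
Context {R : realType} {E : normedModType R}.
Implicit Types (f g : dual E) (x y : E).

Lemma dual_linear f : linear (f : E -> R^o).
Proof. by case: f => f /= /asboolP[]. Qed.

HB.instance Definition _ f :=
  GRing.isLinear.Build R E R^o *:%R (f : E -> R^o) (@dual_linear f).

Lemma dual_continuous f : continuous (f : E -> R^o).
Proof. by case: f => f /= /asboolP[]. Qed.

Lemma dualP f g : (forall x, f x = g x) -> f = g.
Proof. by move=> fg; apply/val_inj/funext. Qed.

Lemma dualDE f g x : (f + g) x = f x + g x. Proof. by []. Qed.

Lemma dualNE f x : (- f) x = - f x. Proof. by []. Qed.

Lemma dualBE f g x : (f - g) x = f x - g x. Proof. by []. Qed.

Lemma dualZE (a : R) f x : (a *: f) x = a * f x. Proof. by []. Qed.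

Lemma bounded_linear_dual_pred (h : E -> R^o) (C : R) : linear h ->
  (forall x, `|h x| <= C * `|x|) -> h \in dual_pred E.
Proof.
move=> lh hC; apply/asboolP; split => //.
pose Lh := GRing.isLinear.Build R E R^o *:%R h lh.
pose L : {linear E -> R^o} := HB.pack h Lh.
apply: (@bounded_linear_continuous _ _ _ L); apply/linear_boundedP.
exists C; split; first exact: num_real.
by move=> r Cr x; rewrite (le_trans (hC x))// ler_wpM2r// ltW.
Qed.

Lemma dual_bounded f : exists C : R, forall x, `|f x| <= C * `|x|.
Proof.
have /linear_boundedP[C [_ hC]] :=
  continuous_linear_bounded (0 : E) (@dual_continuous f 0).
by exists (C + 1) => x; apply: hC; rewrite ltrDl.
Qed.

Definition opnorm f : R := sup [set `|f x| | x in [set x : E | `|x| <= 1]].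

Lemma opnorm_ball_sup f : has_sup [set `|f x| | x in [set x : E | `|x| <= 1]].
Proof.
split; first by exists `|f 0|; exists 0 => //=; rewrite normr0.
have [C hC] := dual_bounded f.
exists `|C| => _ [x /= x1 <-]; rewrite (le_trans (hC x))//.
rewrite (le_trans (ler_wpM2r _ (ler_norm C)))//.
by rewrite -[leRHS]mulr1 ler_wpM2l.
Qed.

Lemma opnorm_ge0 f : 0 <= opnorm f.
Proof.
apply: (@le_trans _ _ `|f 0|) => //.
apply: ub_le_sup; first by case: (opnorm_ball_sup f).
by exists 0 => //=; rewrite normr0.
Qed.

Lemma le_opnorm f x : `|f x| <= opnorm f * `|x|.
Proof.
have [->|x0] := eqVneq x 0; first by rewrite linear0 !normr0 mulr0.
have nx0 : 0 < `|x| by rewrite normr_gt0.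
rewrite -ler_pdivrMr// -[X in X / _]/(`|f x|) mulrC.
have -> : `|x|^-1 * `|f x| = `|f (`|x|^-1 *: x)|.
  by rewrite linearZ /= normrM ger0_norm// invr_ge0.
apply: ub_le_sup; first by case: (opnorm_ball_sup f).
exists (`|x|^-1 *: x) => //=.
by rewrite normrZ normfV normr_id mulVf// gt_eqF.
Qed.

Lemma opnorm_le f (C : R) : 0 <= C -> (forall x, `|f x| <= C * `|x|) ->
  opnorm f <= C.
Proof.
move=> C0 hC; apply: ge_sup; first by case: (opnorm_ball_sup f).
move=> _ [x /= x1 <-]; rewrite (le_trans (hC x))//.
by rewrite -[leRHS]mulr1 ler_wpM2l.
Qed.

Lemma opnormD f g : opnorm (f + g) <= opnorm f + opnorm g.
Proof.
apply: opnorm_le => [|x]; first by rewrite addr_ge0 ?opnorm_ge0.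
by rewrite dualDE (le_trans (ler_normD _ _))// mulrDl lerD ?le_opnorm.
Qed.

Lemma opnormZ (a : R) f : opnorm (a *: f) = `|a| * opnorm f.
Proof.
have le (b : R) g : opnorm (b *: g) <= `|b| * opnorm g.
  apply: opnorm_le => [|x]; first by rewrite mulr_ge0 ?opnorm_ge0.
  by rewrite dualZE normrM -mulrA ler_wpM2l ?le_opnorm.
apply/le_anti; rewrite le/=.
have [->|a0] := eqVneq a 0; first by rewrite normr0 mul0r opnorm_ge0.
have := le a^-1 (a *: f); rewrite scalerA mulVf// scale1r normfV.
by rewrite ler_pdivlMl ?normr_gt0.
Qed.

Lemma opnorm0_eq0 f : opnorm f = 0 -> f = 0.
Proof.
move=> f0; apply: dualP => x; apply/eqP; rewrite -normr_le0.
by rewrite (le_trans (le_opnorm f x))// f0 mul0r.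
Qed.

HB.instance Definition _ :=
  Lmodule_isNormed.Build R (dual E) opnormD opnormZ opnorm0_eq0.

Lemma dual_normE f : `|f| = opnorm f. Proof. by []. Qed.

Lemma le_dual_norm f x : `|f x| <= `|f| * `|x|.
Proof. exact: le_opnorm. Qed.

Lemma dual_norm_le f (C : R) : 0 <= C -> (forall x, `|f x| <= C * `|x|) ->
  `|f| <= C.
Proof. exact: opnorm_le. Qed.

Section DualComplete.
Variable F : set_system (dual E).
Hypotheses (PF : ProperFilter F) (cF : cauchy F).

Let cauchy_norm (e : R) : 0 < e ->
  exists f, F [set g | forall x, `|f x - g x| <= e * `|x|].
Proof.
move=> e0; have /cauchyP/(_ e e0)[f Ff] := cF.
exists f; apply: filterS Ff => g; rewrite -ball_normE /= => fg x.
rewrite -[X in `|X|]dualBE (le_trans (le_dual_norm _ _))//.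
by rewrite ler_wpM2r// ltW.
Qed.

Let ev x : dual E -> R := fun f => f x.

Let cvg_ev x : cvg (ev x @ F).
Proof.
apply/cauchy_cvgP/cauchyP => e e0.
have e1 : 0 < e / (1 + `|x|) by rewrite divr_gt0// ltr_wpDr.
have [f Ff] := cauchy_norm e1; exists (f x).
rewrite /fmap /=; apply: filterS Ff => g /(_ x) fg /=.
rewrite -ball_normE /= (le_lt_trans fg)// mulrAC ltr_pdivrMr ?ltr_wpDr//.
by rewrite ltr_pM2l// ltrDr.
Qed.

Let flim (x : E) : R^o := lim (ev x @ F).

Let flim_linear : linear flim.
Proof.
move=> a x y; apply: (@cvg_lim R^o) => //.
have -> : ev (a *: x + y) = (fun f => a * ev x f + ev y f).
  by apply/funext => f; rewrite /ev linearP.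
by apply: cvgD; [apply: cvgMl_tmp|]; exact: cvg_ev.
Qed.

Let flim_close (e : R) f : 0 < e ->
  F [set g | forall x, `|f x - g x| <= e * `|x|] ->
  forall x, `|f x - flim x| <= e * `|x|.
Proof.
move=> e0 Ff x.
have cvgf : (fun g : dual E => `|f x - ev x g|) @ F --> `|f x - flim x|.
  by apply: cvg_norm; apply: cvgB; [exact: cvg_cst|exact: cvg_ev].
by apply: (cvgr_to_le cvgf); apply: filterS Ff => g; exact.
Qed.

Let flim_dual : flim \in dual_pred E.
Proof.
have [f Ff] := cauchy_norm ltr01.
apply: (@bounded_linear_dual_pred flim (1 + `|f|)) => // x.
rewrite -[flim x](subKr (f x)) (le_trans (ler_normB _ _))//.
by rewrite addrC mulrDl lerD ?(flim_close _ Ff)// le_dual_norm.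
Qed.

Lemma dual_complete : cvg F.
Proof.
apply/cvg_ex; exists (Dual flim_dual).
apply/cvgrPdist_le => /= e e0.
have e2 : 0 < e / 2 by rewrite divr_gt0.
have [f Ff] := cauchy_norm e2; have ff := flim_close e2 Ff.
apply: filterS Ff => g fg.
apply: dual_norm_le => [|x]; first exact: ltW.
rewrite dualBE /= -(subrKA (f x)) (le_trans (ler_normD _ _))//.
rewrite [e]splitr mulrDl lerD ?fg// distrC.
exact: ff.
Qed.

End DualComplete.
End DualNorm.

HB.instance Definition _ (R : realType) (E : normedModType R) :=
  Uniform_isComplete.Build (dual E) (@dual_complete R E).

(* The dual of a Banach lattice is ordered by the cone of positive functionals;
   its lattice operations are given by the Riesz-Kantorovich formula. *)
Section DualOrder.
Context {R : realType} {E : banachLatticeType R}.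
Implicit Types (f g h : dual E) (x y z : E).

Definition dual_le f g : bool := `[< forall x, 0 <= x -> f x <= g x >].

Lemma dual_le_refl : reflexive dual_le.
Proof. by move=> f; apply/asboolP. Qed.

Lemma dual_le_anti : antisymmetric dual_le.
Proof.
move=> f g /andP[/asboolP fg /asboolP gf]; apply: dualP => x.
rewrite (lposBneg x) !linearB /=.
by congr (_ - _); apply/le_anti; rewrite fg ?gf// ?lpos_ge0 ?lneg_ge0.
Qed.

Lemma dual_le_trans : transitive dual_le.
Proof.
move=> g f h /asboolP fg /asboolP gh; apply/asboolP => x x0.
exact: le_trans (fg x x0) (gh x x0).
Qed.

Definition rk_sup f g x : R :=
  sup [set f y + g (x - y) | y in [set y : E | (0 <= y) && (y <= x)]].

Let rk_bound f g x y : 0 <= y -> y <= x ->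
  `|f y + g (x - y)| <= (`|f| + `|g|) * `|x|.
Proof.
move=> y0 yx; rewrite (le_trans (ler_normD _ _))// mulrDl lerD//.
  by rewrite (le_trans (le_dual_norm _ _))// ler_wpM2l// bl_ge0_norm_le.
rewrite (le_trans (le_dual_norm _ _))// ler_wpM2l// bl_ge0_norm_le//.
  by rewrite bl_subr_ge0.
by rewrite bl_lerBlDr -[X in X <= _]addr0 bl_lerD2l.
Qed.

Let rk_has_sup f g x : 0 <= x ->
  has_sup [set f y + g (x - y) | y in [set y : E | (0 <= y) && (y <= x)]].
Proof.
move=> x0; split; first by exists (f 0 + g (x - 0)), 0; rewrite //= lexx x0.
exists ((`|f| + `|g|) * `|x|) => _ [y /= /andP[y0 yx] <-].
by rewrite (le_trans (ler_norm _))// rk_bound.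
Qed.

Lemma le_rk_sup f g x y : 0 <= y -> y <= x -> f y + g (x - y) <= rk_sup f g x.
Proof.
move=> y0 yx; apply: ub_le_sup; last by exists y; rewrite //= y0.
by case: (rk_has_sup f g (le_trans y0 yx)).
Qed.

Lemma rk_sup_le f g x (C : R) : 0 <= x ->
  (forall y, 0 <= y -> y <= x -> f y + g (x - y) <= C) -> rk_sup f g x <= C.
Proof.
move=> x0 hC; apply: ge_sup; first by case: (rk_has_sup f g x0).
by move=> _ [y /= /andP[y0 yx] <-]; exact: hC.
Qed.

Lemma rk_sup_norm f g x : 0 <= x -> `|rk_sup f g x| <= (`|f| + `|g|) * `|x|.
Proof.
move=> x0; rewrite ler_norml; apply/andP; split.
  apply: le_trans (le_rk_sup f g (lexx 0) x0).
  by have := rk_bound f g (lexx 0) x0; rewrite ler_norml => /andP[].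
apply: rk_sup_le => // y y0 yx.
by rewrite (le_trans (ler_norm _))// rk_bound.
Qed.

Lemma rk_supD f g x y : 0 <= x -> 0 <= y ->
  rk_sup f g (x + y) = rk_sup f g x + rk_sup f g y.
Proof.
move=> x0 y0; apply/le_anti/andP; split.
  apply: rk_sup_le => [|z z0 zxy]; first exact: bl_addr_ge0.
  have [u /andP[u0 ux] /andP[zu0 zuy]] := riesz_decomposition x0 y0 z0 zxy.
  have -> : f z + g (x + y - z) =
      (f u + g (x - u)) + (f (z - u) + g (y - (z - u))).
    rewrite addrACA -!linearD; congr (f _ + g _); first by rewrite subrKC.
    by rewrite addrACA -opprD [u + _]subrKC.
  by apply: lerD; exact: le_rk_sup.
rewrite -lerBrDr; apply: rk_sup_le => // u u0 ux.
rewrite lerBrDl -lerBrDr; apply: rk_sup_le => // v v0 vy.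
rewrite lerBrDr addrACA -!linearD /=.
have -> : y - v + (x - u) = x + y - (v + u) by rewrite addrACA -opprD [y + x]addrC.
by apply: le_rk_sup; rewrite ?bl_addr_ge0// [v + u]addrC bl_lerD.
Qed.

Lemma rk_supZ f g (a : R) x : 0 <= a -> 0 <= x ->
  rk_sup f g (a *: x) = a * rk_sup f g x.
Proof.
have le (b : R) y : 0 < b -> 0 <= y -> b * rk_sup f g y <= rk_sup f g (b *: y).
  move=> b0 y0; rewrite mulrC -ler_pdivlMr//.
  apply: rk_sup_le => // z z0 zy; rewrite ler_pdivlMr// mulrC mulrDr.
  rewrite -[b * f z]/(b *: (f z : R^o)) -[b * g _]/(b *: (g _ : R^o)).
  rewrite -!linearZ /= scalerBr.
  by apply: le_rk_sup; rewrite ?bl_scale_ge0 ?bl_leZ2l// ltW.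
move=> a0 x0; have [->|an0] := eqVneq a 0.
  rewrite scale0r mul0r; apply/eqP; rewrite -normr_le0.
  by have := rk_sup_norm f g (lexx 0); rewrite normr0 mulr0.
have {a0} a0 : 0 < a by rewrite lt_neqAle eq_sym an0.
apply/le_anti; rewrite le// andbT -ler_pdivrMl//.
have := le a^-1 (a *: x); rewrite scalerA mulVf// scale1r; apply.
  by rewrite invr_gt0.
by rewrite bl_scale_ge0// ltW.
Qed.

Definition dual_join_fun f g x : R^o :=
  rk_sup f g (lpos x) - rk_sup f g (lneg x).

Let join_funB f g x y : 0 <= x -> 0 <= y ->
  dual_join_fun f g (x - y) = rk_sup f g x - rk_sup f g y.
Proof.
move=> x0 y0; rewrite /dual_join_fun.
move: (lposBneg (x - y)) (lpos_ge0 (x - y)) (lneg_ge0 (x - y)).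
move: (lpos _) (lneg _) => p n /eqP.
rewrite subr_eq addrAC eq_sym subr_eq => /eqP pyxn p0 n0.
apply/eqP; rewrite subr_eq addrAC eq_sym subr_eq -!rk_supD//.
by rewrite pyxn.
Qed.

Lemma dual_join_fun_ge0 f g x : 0 <= x -> dual_join_fun f g x = rk_sup f g x.
Proof.
move=> x0; rewrite -[in LHS](subr0 x) join_funB//.
have := rk_supD f g (lexx 0) (lexx 0); rewrite addr0 => /eqP.
by rewrite -subr_eq subrr eq_sym => /eqP ->; rewrite subr0.
Qed.

Let join_fun_linear f g : linear (dual_join_fun f g).
Proof.
have lZ a x : dual_join_fun f g (a *: x) = a * dual_join_fun f g x.
  have [a0|a0] := leP 0 a.
    rewrite {1}(lposBneg x) scalerBr.
    by rewrite join_funB ?bl_scale_ge0 ?lpos_ge0 ?lneg_ge0// !rk_supZ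
      ?lpos_ge0 ?lneg_ge0// -mulrBr.
  have Na0 : 0 <= - a by rewrite oppr_ge0 ltW.
  rewrite {1}(lposBneg x) -[a]opprK scaleNr -scalerN opprB scalerBr.
  rewrite join_funB ?bl_scale_ge0 ?lpos_ge0 ?lneg_ge0// !rk_supZ
    ?lpos_ge0 ?lneg_ge0//.
  by rewrite opprK -mulrBr -[X in - a * X]opprB mulrNN.
move=> a x y.
rewrite -[a *: dual_join_fun f g x]/(a * dual_join_fun f g x) -lZ.
move: (a *: x) => {a}x; rewrite {1}(lposBneg x) {1}(lposBneg y).
rewrite addrACA -opprD join_funB ?bl_addr_ge0 ?lpos_ge0 ?lneg_ge0//.
rewrite !rk_supD ?lpos_ge0 ?lneg_ge0//.
by rewrite opprD addrACA.
Qed.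

Let join_fun_dual f g : dual_join_fun f g \in dual_pred E.
Proof.
apply: (@bounded_linear_dual_pred _ _ _ ((`|f| + `|g|) *+ 2)) => // x.
rewrite (le_trans (ler_normB _ _))// mulrnAl mulr2n.
apply: lerD; apply: le_trans (rk_sup_norm _ _ _) _;
  rewrite ?lpos_ge0 ?lneg_ge0// ler_wpM2l ?addr_ge0//.
  exact: norm_lpos_le.
exact: norm_lneg_le.
Qed.

Definition dual_join f g : dual E := Dual (join_fun_dual f g).
Definition dual_meet f g : dual E := - dual_join (- f) (- g).

Lemma dual_joinE f g x : 0 <= x ->
  dual_join f g x = sup [set f y + g (x - y) | y in
                           [set y : E | (0 <= y) && (y <= x)]].
Proof. exact: dual_join_fun_ge0. Qed.

Lemma dual_joinP f g h :
  dual_le (dual_join f g) h = dual_le f h && dual_le g h.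
Proof.
apply/asboolP/andP => [H|[/asboolP fh /asboolP gh] x x0].
  split; apply/asboolP => x x0; apply: le_trans (H x x0);
    rewrite /= dual_join_fun_ge0//.
    by have := le_rk_sup f g x0 (lexx x); rewrite subrr linear0 addr0.
  by have := le_rk_sup f g (lexx 0) x0; rewrite subr0 linear0 add0r.
rewrite /= dual_join_fun_ge0//; apply: rk_sup_le => // y y0 yx.
have -> : h x = h y + h (x - y) by rewrite -linearD subrKC.
by rewrite lerD ?fh ?gh ?bl_subr_ge0.
Qed.

Lemma dual_leN2 f g : dual_le (- f) (- g) = dual_le g f.
Proof.
by apply/asboolP/asboolP => H x /H; rewrite !dualNE lerN2.
Qed.

Lemma dual_meetP f g h :
  dual_le f (dual_meet g h) = dual_le f g && dual_le f h.
Proof. by rewrite -dual_leN2 opprK dual_joinP !dual_leN2. Qed.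

Lemma dual_leD h f g : dual_le f g -> dual_le (f + h) (g + h).
Proof. by move=> /asboolP H; apply/asboolP => x /H; rewrite !dualDE lerD2r. Qed.

Lemma dual_leZ (a : R) f g : 0 <= a -> dual_le f g -> dual_le (a *: f) (a *: g).
Proof.
by move=> a0 /asboolP H; apply/asboolP => x /H; rewrite !dualZE; exact: ler_wpM2l.
Qed.

Let dual_abs f := dual_join f (- f).

Let le_dual_abs f x : `|f x| <= dual_abs f (labs x).
Proof.
have /andP[/asboolP hf /asboolP hNf] :
  dual_le f (dual_abs f) && dual_le (- f) (dual_abs f).
  by rewrite -dual_joinP dual_le_refl.
have y1 : 0 <= labs x + x by rewrite -[X in _ + X]opprK bl_subr_ge0 leN_labs.
have y2 : 0 <= labs x - x by rewrite bl_subr_ge0 le_labs.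
move: (dual_abs f) hf hNf => h hf hNf.
have := (hf _ y1, hf _ y2, hNf _ y1, hNf _ y2).
rewrite !dualNE !linearB !linearD /=.
have aux (a b c d : R) : b + a <= d + c -> b - a <= d - c ->
    - b - a <= d + c -> - b - - a <= d - c -> `|a| <= d.
  by move=> *; rewrite ler_norml; apply/andP; split; lra.
by move=> [[[h1 h2] h3] h4]; exact: (aux _ _ _ _ h1 h2 h3 h4).
Qed.

Let dual_abs_le f x : 0 <= x -> dual_abs f x <= `|f| * `|x|.
Proof.
move=> x0; rewrite dual_joinE//; apply: rk_sup_le => // y y0 yx.
rewrite dualNE -linearB (le_trans (ler_norm _))//.
rewrite (le_trans (le_dual_norm _ _))// ler_wpM2l// opprB addrA.
apply: bl_norm_le_between.
  by rewrite bl_lerBrDr addNr bl_addr_ge0.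
by rewrite bl_lerBlDr bl_lerD.
Qed.

Lemma dual_norm_mono f g :
  dual_le (dual_join f (- f)) (dual_join g (- g)) -> `|f| <= `|g|.
Proof.
move=> /asboolP fg; apply: dual_norm_le => // x.
rewrite (le_trans (le_dual_abs f x))// (le_trans (fg _ (labs_ge0 x)))//.
by rewrite (le_trans (dual_abs_le g (labs_ge0 x)))// norm_labs.
Qed.

HB.instance Definition _ := isBanachLattice.Build R (dual E)
  dual_le_refl dual_le_anti dual_le_trans dual_meetP dual_joinP
  dual_leD dual_leZ dual_norm_mono.

End DualOrder.

HB.instance Definition _ (R : realType) (E : banachLatticeType R) :=
  Order.Lattice.copy (dual E) (dual E : banachLatticeType R).

Lemma dual_leP (R : realType) (E : banachLatticeType R) (f g : dual E) :
  reflect (forall x : E, 0 <= x -> f x <= g x) (f <= g).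
Proof. exact: asboolP. Qed.

Section Sequences.
Context {R : realType}.

Definition norm_null (E : normedModType R) (x : nat -> E) :=
  x n @[n --> \oo] --> (0 : E).

Definition weakly_null (E : normedModType R) (x : nat -> E) :=
  forall f : dual E, f (x n) @[n --> \oo] --> (0 : R).

Definition weak_star_null (E : normedModType R) (f : nat -> dual E) :=
  forall x : E, f n x @[n --> \oo] --> (0 : R).

Definition norm_bounded (E : normedModType R) (x : nat -> E) :=
  exists C : R, forall n, `|x n| <= C.

Definition disjoint_seq (E : banachLatticeType R) (x : nat -> E) :=
  forall n k, n != k -> Order.meet (labs (x n)) (labs (x k)) = (0 : E).

Definition positive_seq (E : banachLatticeType R) (x : nat -> E) :=
  forall n, 0 <= x n.

End Sequences.

Section OrderContinuousNorm.
Context {R : realType}.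

Definition directed (I : Type) (le : I -> I -> Prop) :=
  [/\ inhabited I, forall i, le i i,
      forall i j k, le i j -> le j k -> le i k
    & forall i j, exists k, le i k /\ le j k].

Definition decreases_to_0 (E : banachLatticeType R) (I : Type)
    (le : I -> I -> Prop) (x : I -> E) :=
  [/\ forall i j, le i j -> x j <= x i,
      forall i, 0 <= x i
    & forall z : E, (forall i, z <= x i) -> z <= 0].

Definition order_continuous_norm (E : banachLatticeType R) :=
  forall (I : Type) (le : I -> I -> Prop) (x : I -> E),
    directed le -> decreases_to_0 le x ->
    forall e : R, 0 < e -> exists i0, forall i, le i0 i -> `|x i| < e.

End OrderContinuousNorm.

Section BilinearOperators.
Context {R : realType}.

Definition positive_form (E1 E2 : banachLatticeType R)
    (A : {bilinear E1 -> E2 -> R^o}) :=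
  forall (x : E1) (y : E2), 0 <= x -> 0 <= y -> 0 <= (A x y : R).

Definition almost_dunford_pettis (E1 E2 : banachLatticeType R)
    (G : completeNormedModType R) (A : {bilinear E1 -> E2 -> G}) :=
  forall (x1 : nat -> E1) (x2 : nat -> E2),
    disjoint_seq x1 -> weakly_null x1 ->
    disjoint_seq x2 -> weakly_null x2 ->
    norm_null (fun n => A (x1 n) (x2 n)).

Definition weakly_positively_limited (X1 X2 : banachLatticeType R)
    (G : completeNormedModType R) (B : {bilinear dual X1 -> dual X2 -> G}) :=
  (forall (f1 : nat -> dual X1) (f2 : nat -> dual X2),
     positive_seq f1 -> weak_star_null f1 ->
     positive_seq f2 -> norm_bounded f2 ->
     norm_null (fun n => B (f1 n) (f2 n))) /\
  (forall (f1 : nat -> dual X1) (f2 : nat -> dual X2),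
     positive_seq f1 -> norm_bounded f1 ->
     positive_seq f2 -> weak_star_null f2 ->
     norm_null (fun n => B (f1 n) (f2 n))).

End BilinearOperators.

Section AronBerner.
Context {R : realType} {E1 E2 : normedModType R}.
Variables (A : {bilinear E1 -> E2 -> R^o}).
Hypothesis cA : continuous (fun p : E1 * E2 => A p.1 p.2).

Let bA : exists2 C : R, 0 <= C & forall x y, `|A x y| <= C * `|x| * `|y|.
Proof. by have [C C0 hC] := bilinear_schwarz cA; exists C => //; exact: ltW. Qed.

Lemma section_l_dual (y : E2) : (fun x => A x y) \in dual_pred E1.
Proof.
have [C C0 hC] := bA.
apply: (@bounded_linear_dual_pred _ _ _ (C * `|y|)) => [a u v|x].
  by rewrite linearPl.
by rewrite mulrAC hC.
Qed.

Lemma section_r_dual (x : E1) : (fun y => A x y) \in dual_pred E2.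
Proof.
have [C C0 hC] := bA.
apply: (@bounded_linear_dual_pred _ _ _ (C * `|x|)) => [a u v|y].
  by rewrite linearPr.
exact: hC.
Qed.

Definition section_l (y : E2) : dual E1 := Dual (section_l_dual y).
Definition section_r (x : E1) : dual E2 := Dual (section_r_dual x).

Lemma lift_l_dual (x'' : dual (dual E1)) :
  (fun y => x'' (section_l y)) \in dual_pred E2.
Proof.
have [C C0 hC] := bA.
apply: (@bounded_linear_dual_pred _ _ _ (`|x''| * C)) => [a u v|y].
  rewrite -linearP; congr (x'' _); apply: dualP => x /=.
  by rewrite linearPr.
rewrite (le_trans (le_dual_norm _ _))// -mulrA ler_wpM2l//.
apply: dual_norm_le => [|x /=]; first by rewrite mulr_ge0.
by rewrite mulrAC hC.
Qed.

Lemma lift_r_dual (y'' : dual (dual E2)) :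
  (fun x => y'' (section_r x)) \in dual_pred E1.
Proof.
have [C C0 hC] := bA.
apply: (@bounded_linear_dual_pred _ _ _ (`|y''| * C)) => [a u v|x].
  rewrite -linearP; congr (y'' _); apply: dualP => y /=.
  by rewrite linearPl.
rewrite (le_trans (le_dual_norm _ _))// -mulrA ler_wpM2l//.
apply: dual_norm_le => [|y /=]; first by rewrite mulr_ge0.
exact: hC.
Qed.

Definition lift_l (x'' : dual (dual E1)) : dual E2 := Dual (lift_l_dual x'').
Definition lift_r (y'' : dual (dual E2)) : dual E1 := Dual (lift_r_dual y'').

(* 'S_2 consists of 1 and the transposition:
   rho = 1 gives y''(y |-> x''(A(., y))),
   the transposition gives x''(x |-> y''(A(x, .))). *)
Definition aron_berner_fun (rho : 'S_2)
    (x'' : dual (dual E1)) (y'' : dual (dual E2)) : R^o :=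
  if rho == 1%g then y'' (lift_l x'') else x'' (lift_r y'').

Lemma aron_berner_bilinear rho :
  bilinear_for (GRing.Scale.Law.clone _ _ *:%R _)
    (GRing.Scale.Law.clone _ _ *:%R _) (aron_berner_fun rho).
Proof.
split=> [y''|x''] a u v; rewrite /aron_berner_fun; case: ifP => _ //.
- by rewrite -linearP; congr (y'' _); exact: dualP.
- by rewrite -linearP; congr (x'' _); exact: dualP.
Qed.

HB.instance Definition _ rho :=
  bilinear_isBilinear.Build R (dual (dual E1)) (dual (dual E2)) R^o _ _
    (aron_berner_fun rho) (aron_berner_bilinear rho).

Definition aron_berner (rho : 'S_2) :
  {bilinear dual (dual E1) -> dual (dual E2) -> R^o} := aron_berner_fun rho.

End AronBerner.

(* A positive bilinear form on Banach lattices is automatically continuous, so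
   its Aron-Berner extensions exist without any continuity assumption. *)
Section PositiveFormContinuous.
Context {R : realType}.

Lemma bl_cvg_ge0 (E : banachLatticeType R) (u : nat -> E) (l : E) :
  u n @[n --> \oo] --> l -> (\forall n \near \oo, 0 <= u n) -> 0 <= l.
Proof.
move=> ul u0; suff l0 : lneg l = 0.
  by rewrite (lposBneg l) l0 subr0 lpos_ge0.
apply/eqP; rewrite -normr_le0; apply/ler_addgt0Pr => e e0; rewrite add0r.
move/cvgrPdist_le : ul => /(_ e e0) ul; near \oo => n.
have un0 : 0 <= u n by near: n.
apply: (@le_trans _ _ `|l - u n|); last by near: n.
rewrite distrC -[leRHS]norm_labs; apply: bl_ge0_norm_le (lneg_ge0 l) _.
rewrite leUx labs_ge0 andbT (le_trans _ (le_labs _))//.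
by rewrite -[X in X <= _]add0r bl_lerD2r.
Unshelve. all: by end_near. Qed.

Lemma bl_dyadic_series (E : banachLatticeType R) (u : nat -> E) :
  (forall n, 0 <= u n) -> (forall n, `|u n| = 1) ->
  exists s : E, forall n, 2^-1 ^+ n *: u n <= s.
Proof.
move=> u0 u1; pose v n : E := 2^-1 ^+ n *: u n.
have half0 n : 0 <= 2^-1 ^+ n :> R by rewrite exprn_ge0// invr_ge0.
have v0 n : 0 <= v n by exact: bl_scale_ge0.
have cv : cvg (series v @ \oo).
  apply: normed_cvg.
  have -> : [normed series v] = series (geometric 1 (2^-1 : R)).
    congr series; apply/funext => n /=.
    by rewrite normrZ u1 mulr1 mul1r ger0_norm.
  apply: is_cvg_geometric_series.
  by rewrite ger0_norm ?invr_ge0// invf_lt1// ltr1n.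
exists (lim (series v @ \oo)) => n; rewrite -bl_subr_ge0.
apply: (@bl_cvg_ge0 E (fun m => series v m - v n)).
  by apply: cvgB => //; exact: cvg_cst.
exists n.+1 => // m /= nm; rewrite bl_subr_ge0 /series /=.
elim: m nm => // m IH; rewrite ltnS leq_eqVlt => /orP[/eqP ->|nm].
  rewrite big_nat_recr//= -[X in X <= _]add0r bl_lerD2r.
  by apply: (big_ind (fun z : E => 0 <= z)) => [||k _];
    [exact: lexx|exact: bl_addr_ge0|exact: v0].
by rewrite big_nat_recr//= -[X in X <= _]addr0 bl_lerD// IH.
Qed.

Variables (E1 E2 : banachLatticeType R) (A : {bilinear E1 -> E2 -> R^o}).
Hypothesis A0 : positive_form A.

Let A_mono (x x' : E1) (y y' : E2) : 0 <= x -> x <= x' -> 0 <= y -> y <= y' ->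
  (A x y : R) <= A x' y'.
Proof.
move=> x0 xx' y0 yy'; apply: (@le_trans _ _ (A x' y : R)).
  by rewrite -subr_ge0 -linearBl A0// bl_subr_ge0.
by rewrite -subr_ge0 -linearBr A0// ?bl_subr_ge0// (le_trans x0).
Qed.

Let A_cone_bounded : exists2 C : R, 0 <= C &
  forall (x : E1) (y : E2), 0 <= x -> 0 <= y -> (A x y : R) <= C * `|x| * `|y|.
Proof.
apply: contrapT => nC.
have /choice[xy hxy] : forall n, exists xy : E1 * E2,
    [/\ 0 <= xy.1, 0 <= xy.2, `|xy.1| = 1, `|xy.2| = 1
      & (8 ^+ n : R) < A xy.1 xy.2].
  move=> n; apply: contrapT => nxy; apply: nC.
  exists (8 ^+ n); first by rewrite exprn_ge0.
  move=> x y x0 y0; rewrite leNgt; apply/negP => hA; apply: nxy.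
  have nx0 : x != 0.
    by apply: contraTN hA => /eqP->; rewrite linear0l normr0 mulr0 mul0r ltxx.
  have ny0 : y != 0.
    by apply: contraTN hA => /eqP->; rewrite linear0r normr0 mulr0 ltxx.
  exists (`|x|^-1 *: x, `|y|^-1 *: y); split => /=.
  - by rewrite bl_scale_ge0// invr_ge0.
  - by rewrite bl_scale_ge0// invr_ge0.
  - by rewrite normrZ normfV normr_id mulVf// normr_eq0.
  - by rewrite normrZ normfV normr_id mulVf// normr_eq0.
  - rewrite linearZl linearZr /= -![_ *: _]/(_ * _).
    rewrite mulrA -invfM ltr_pdivlMl ?mulr_gt0 ?normr_gt0//.
    by rewrite mulrC mulrA // mulrAC.
have [|n|s1 hs1] := @bl_dyadic_series E1 (fun n => (xy n).1).
- by move=> n; case: (hxy n).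
- by case: (hxy n).
have [|n|s2 hs2] := @bl_dyadic_series E2 (fun n => (xy n).2).
- by move=> n; case: (hxy n).
- by case: (hxy n).
pose n := (Num.truncn (A s1 s2 : R)).+1.
have : (A s1 s2 : R) < 2 ^+ n.
  rewrite (lt_trans (truncnS_gt _))// -/n -natrX ltr_nat.
  exact: ltn_expl.
apply/negP; rewrite -leNgt.
have [x0 y0 _ _ /ltW hn] := hxy n.
have h0 : 0 <= 2^-1 ^+ n :> R by rewrite exprn_ge0// invr_ge0.
apply: le_trans (A_mono (bl_scale_ge0 h0 x0) (hs1 n)
                        (bl_scale_ge0 h0 y0) (hs2 n)).
rewrite linearZl linearZr /= -![_ *: _]/(_ * _) mulrA -exprMn.
have -> : 2 ^+ n = (2^-1 * 2^-1) ^+ n * 8 ^+ n :> R.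
  by rewrite -exprMn; congr (_ ^+ _); lra.
by rewrite ler_wpM2l// exprn_ge0// mulr_ge0 ?invr_ge0.
Qed.

Lemma positive_form_bounded : exists2 C : R, 0 <= C &
  forall (x : E1) (y : E2), `|A x y| <= C * `|x| * `|y|.
Proof.
have [C C0 hC] := A_cone_bounded.
have le (x : E1) (y : E2) : 0 <= x -> 0 <= y -> `|A x y| <= C * `|x| * `|y|.
  by move=> x0 y0; rewrite ger0_norm ?A0// hC.
have le1 (x : E1) (y : E2) : 0 <= x -> `|A x y| <= (C *+ 2) * `|x| * `|y|.
  move=> x0; rewrite {1}(lposBneg y) linearBr (le_trans (ler_normB _ _))//.
  rewrite mulrnAl mulrnAl mulr2n lerD// (le_trans (le _ _ _ _))//
    ?lpos_ge0 ?lneg_ge0// ler_wpM2l ?mulr_ge0//.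
    exact: norm_lpos_le.
  exact: norm_lneg_le.
exists (C *+ 4) => [|x y]; first exact: mulrn_wge0.
rewrite {1}(lposBneg x) linearBl (le_trans (ler_normB _ _))//.
have -> : C *+ 4 * `|x| * `|y| = C *+ 2 * `|x| * `|y| + C *+ 2 * `|x| * `|y|.
  by rewrite -!mulrDl -mulrnDr.
apply: lerD.
  apply: le_trans (le1 _ _ (lpos_ge0 x)) _.
  by rewrite ler_wpM2r// ler_wpM2l ?mulrn_wge0// norm_lpos_le.
apply: le_trans (le1 _ _ (lneg_ge0 x)) _.
by rewrite ler_wpM2r// ler_wpM2l ?mulrn_wge0// norm_lneg_le.
Qed.

Lemma positive_form_continuous : continuous (fun p : E1 * E2 => A p.1 p.2).
Proof.
have [C C0 hC] := positive_form_bounded.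
move=> [x0 y0]; apply/subr_cvg0/norm_cvg0P => /=.
pose b (p : E1 * E2) : R := C * `|p.1 - x0| * `|y0| + C * `|p.1| * `|p.2 - y0|.
have b0 : b p @[p --> (x0, y0)] --> (0 : R).
  have -> : 0 = C * `|x0 - x0| * `|y0| + C * `|x0| * `|y0 - y0| :> R.
    by rewrite !subrr !normr0 !mulr0 mul0r addr0.
  apply: cvgD; [apply: cvgMr_tmp; apply: cvgMl_tmp|apply: cvgM];
    [|apply: cvgMl_tmp|]; apply: cvg_norm => //;
    [apply: cvgB|exact: cvg_fst|apply: cvgB];
    [exact: cvg_fst|exact: cvg_cst|exact: cvg_snd|exact: cvg_cst].
apply: (squeeze_cvgr _ (cvg_cst 0) b0); apply: nearW => -[x y] /=.
rewrite normr_ge0 /b /=.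
have -> : A x y - A x0 y0 = A (x - x0) y0 + A x (y - y0).
  by rewrite linearBl linearBr [RHS]addrC subrKA.
by rewrite (le_trans (ler_normD _ _))// lerD.
Qed.

End PositiveFormContinuous.

(* Main.v *)
(* The o.c. norm of E_i^* makes bounded disjoint sequences of E_i weakly null:
   if f_n is the restriction of f >= 0 to the ideal of x_0, ..., x_(n-1) and g
   its restriction to the ideal of all x_i, then g - f_n decreases to 0 and
   takes the value f(x_n) at x_n. Hence A(x_n, y_n) -> 0 for all positive bounded
   disjoint sequences. Disjointifying both variables at once, there are x0, y0
   with A((x - x0)^+, (y - y0)^+) <= e on the positive unit balls; with the same
   statement for the functional A(x1, .) this gives A(x, y) <= A(x, y0) + e, and
   symmetrically A(x, y) <= A(x0, y) + e. Both estimates pass to the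
   Aron-Berner extension as bounds by x''(A(., y0)) and y''(A(x0, .)), which
   vanish along weak*-null sequences. Finally, a disjoint weakly null sequence
   z_n has weakly null positive parts: restrict f to the ideal generated by the
   z_n^+ and evaluate at z_n. *)
Require Import Defs.
From HB Require Import structures.
From mathcomp Require Import all_boot all_order all_algebra all_fingroup.
From mathcomp Require Import all_classical all_reals all_analysis.
From mathcomp Require Import ring lra.
Import Order.TTheory GRing.Theory Num.Theory.
Import numFieldNormedType.Exports.
Local Open Scope classical_set_scope.
Local Open Scope ring_scope.

Set Implicit Arguments.
Unset Strict Implicit.
Unset Printing Implicit Defensive.

(** * Riesz space inequalities and extension of additive maps from the cone *)

Section RieszSpace.
Context {R : realType} {E : banachLatticeType R}.
Implicit Types (u v w x y z : E) (F : E -> R).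

Lemma lpos_mono x y : x <= y -> lpos x <= lpos y.
Proof. by move=> xy; rewrite leUx (le_trans xy) ?leUl// lpos_ge0. Qed.

Lemma lpos_le x y : 0 <= y -> x <= y -> lpos x <= y.
Proof. by move=> y0 xy; rewrite leUx xy. Qed.

Lemma lposB_le x y : 0 <= x -> 0 <= y -> lpos (x - y) <= x.
Proof.
move=> x0 y0; apply: lpos_le => //.
by rewrite bl_lerBlDr -[X in X <= _]addr0 bl_lerD2l.
Qed.

Lemma labsN x : labs (- x) = labs x.
Proof. by rewrite /labs opprK joinC. Qed.

Lemma lpos_le_labs x : lpos x <= labs x.
Proof. by rewrite lpos_le ?labs_ge0 ?le_labs. Qed.

Lemma lneg_le_labs x : lneg x <= labs x.
Proof. by rewrite lpos_le ?labs_ge0 ?leN_labs. Qed.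

(** If [d] is the meet, [lpos x - d] is still an upper bound of [x] and [0], hence dominates
    [lpos x]. *)
Lemma meet_lpos_lneg x : Order.meet (lpos x) (lneg x) = 0.
Proof.
apply/le_anti; rewrite lexI lpos_ge0 lneg_ge0 !andbT.
set d := Order.meet _ _.
have h : lpos x <= lpos x - d.
  rewrite leUx bl_lerBrDr {1}(lposBneg x) addrAC bl_lerBlDr bl_lerD2l leIr /=.
  by rewrite bl_subr_ge0 leIl.
by move: h; rewrite bl_lerBrDr -[leRHS]addr0 bl_lerD2l.
Qed.

Lemma subr_lposB_le x y : x - lpos (x - y) <= y.
Proof. by rewrite bl_lerBlDr addrC -bl_lerBlDr leUl. Qed.

(** Riesz decomposition cuts the left-hand side into a piece below [y] and a piece below [z]; both
    pieces also stay below [x]. *)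
Lemma meet_subadditive x y z : 0 <= x -> 0 <= y -> 0 <= z ->
  Order.meet x (y + z) <= Order.meet x y + Order.meet x z.
Proof.
move=> x0 y0 z0; set t := Order.meet x _.
have t0 : 0 <= t by rewrite lexI x0 bl_addr_ge0.
have [|u /andP[u0 uy] /andP[tu0 tuz]] := @riesz_decomposition _ _ y z t y0 z0 t0.
  exact: leIr.
have tx : t <= x by exact: leIl.
rewrite -(subrKC u t) bl_lerD// lexI ?uy ?tuz andbT.
  by rewrite (le_trans _ tx)// -bl_subr_ge0.
by rewrite (le_trans _ tx)// bl_lerBlDr -[X in X <= _]addr0 bl_lerD2l.
Qed.

(** Dividing [w] by [1 + c] puts it below both [u] and [v], hence below their meet [0]. The divisor
    [1 + c] also covers [c < 1]. *)
Lemma le_disjoint_scale_eq0 u v w (c : R) : 0 <= u -> 0 <= v ->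
  Order.meet u v = 0 -> 0 <= c -> 0 <= w -> w <= u -> w <= c *: v -> w = 0.
Proof.
move=> u0 v0 uv c0 w0 wu wv; apply/le_anti; rewrite w0 andbT.
have c1 : 0 < 1 + c by rewrite ltr_pwDl.
have ic0 : 0 <= (1 + c)^-1 by rewrite invr_ge0 ltW.
suff h : (1 + c)^-1 *: w <= 0.
  have := bl_leZ2l (ltW c1) h.
  by rewrite scalerA mulfV ?gt_eqF// scale1r scaler0.
rewrite -uv lexI; apply/andP; split.
  apply: le_trans wu; rewrite -bl_subr_ge0 -{1}[w]scale1r -scalerBl.
  by rewrite bl_scale_ge0// subr_ge0 invf_le1// lerDl.
apply: le_trans (bl_leZ2l ic0 wv) _; rewrite scalerA.
rewrite -bl_subr_ge0 -{1}[v]scale1r -scalerBl bl_scale_ge0// subr_ge0.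
by rewrite ler_pdivrMl// mulr1 lerDr.
Qed.

Lemma meet_sum_eq0 (I : eqType) (s : seq I) (x : I -> E) v : 0 <= v ->
  (forall i, 0 <= x i) -> {in s, forall i, Order.meet v (x i) = 0} ->
  Order.meet v (\sum_(i <- s) x i) = 0.
Proof.
move=> v0 x0; elim: s => [|i s IH] h.
  by rewrite big_nil; apply/le_anti; rewrite leIr lexI v0 lexx.
have s0 : 0 <= \sum_(j <- s) x j.
  by apply: (big_ind (fun z : E => 0 <= z)) => //; exact: bl_addr_ge0.
rewrite big_cons; apply/le_anti/andP; split; last by rewrite lexI v0 bl_addr_ge0.
rewrite (le_trans (meet_subadditive v0 (x0 i) s0))//.
rewrite h ?mem_head// add0r IH// => j js.
by apply: h; rewrite in_cons js orbT.
Qed.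

(** By additivity, [F x - F y] depends only on [x - y] for positive [x] and [y], so the difference
    of the values at [lpos x] and [lneg x] is linear in [x]. *)
Lemma cone_extension F (C : R) :
  (forall x y, 0 <= x -> 0 <= y -> F (x + y) = F x + F y) ->
  (forall (a : R) x, 0 <= a -> 0 <= x -> F (a *: x) = a * F x) ->
  (forall x, 0 <= x -> `|F x| <= C * `|x|) ->
  exists g : dual E, forall x, 0 <= x -> g x = F x.
Proof.
move=> FD FZ FC; pose g x : R^o := F (lpos x) - F (lneg x).
have gB x y : 0 <= x -> 0 <= y -> g (x - y) = F x - F y.
  move=> x0 y0; rewrite /g.
  move: (lposBneg (x - y)) (lpos_ge0 (x - y)) (lneg_ge0 (x - y)).
  move: (lpos _) (lneg _) => p n /eqP.
  rewrite subr_eq addrAC eq_sym subr_eq => /eqP pyxn p0 n0.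
  apply/eqP; rewrite subr_eq addrAC eq_sym subr_eq -!FD//.
  by rewrite pyxn.
have gZ a x : g (a *: x) = a * g x.
  have [a0|a0] := leP 0 a.
    rewrite {1}(lposBneg x) scalerBr gB ?bl_scale_ge0 ?lpos_ge0 ?lneg_ge0//.
    by rewrite !FZ ?lpos_ge0 ?lneg_ge0// -mulrBr.
  have Na0 : 0 <= - a by rewrite oppr_ge0 ltW.
  rewrite {1}(lposBneg x) -[a]opprK scaleNr -scalerN opprB scalerBr.
  rewrite gB ?bl_scale_ge0 ?lpos_ge0 ?lneg_ge0// !FZ ?lpos_ge0 ?lneg_ge0//.
  by rewrite opprK -mulrBr -[X in - a * X]opprB mulrNN.
have lg : linear g.
  move=> a x y; rewrite -[a *: g x]/(a * g x) -gZ.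
  move: (a *: x) => {a}x; rewrite {1}(lposBneg x) {1}(lposBneg y).
  rewrite addrACA -opprD gB ?bl_addr_ge0 ?lpos_ge0 ?lneg_ge0//.
  by rewrite !FD ?lpos_ge0 ?lneg_ge0// opprD addrACA.
have dg : g \in dual_pred E.
  apply: (@bounded_linear_dual_pred _ _ _ (`|C| *+ 2)) => // x.
  rewrite (le_trans (ler_normB _ _))// mulrnAl mulr2n.
  have FC' y : 0 <= y -> `|y| <= `|x| -> `|F y| <= `|C| * `|x|.
    move=> y0 yx; rewrite (le_trans (FC _ y0))//.
    by rewrite (le_trans (ler_wpM2r _ (ler_norm C)))// ler_wpM2l.
  by rewrite lerD// FC' ?lpos_ge0 ?lneg_ge0 ?norm_lpos_le ?norm_lneg_le.
exists (Dual dg) => x x0.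
have F0 : F 0 = 0 by have := FZ 0 0; rewrite scaler0 mul0r; apply.
by rewrite -[in LHS](subr0 x) [LHS]gB// F0 subr0.
Qed.

End RieszSpace.

(** * Restriction of positive functionals to ideals; disjoint sequences *)

Section IdealRestriction.
Context {R : realType} {E : banachLatticeType R}.
Implicit Types (f g : dual E) (u v w y : E) (x : nat -> E).

Lemma pos_dual_ge0 f u : 0 <= f -> 0 <= u -> 0 <= f u.
Proof. by move=> /dual_leP f0 /f0. Qed.

Lemma pos_dual_mono f u v : 0 <= f -> u <= v -> f u <= f v.
Proof. by move=> f0 uv; rewrite -subr_ge0 -linearB pos_dual_ge0// bl_subr_ge0. Qed.

(** For [y >= 0], [g y] is the supremum of [f] over the elements of [W] between [0] and [y], and the
    two conclusions characterise it as such. Additivity comes from Riesz decomposition: the pieces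
    of an element of [W] remain in [W], which is closed downwards. *)
Lemma ideal_restriction f (W : set E) : 0 <= f -> W 0 ->
  (forall u v, W u -> W v -> W (u + v)) ->
  (forall (a : R) u, 0 <= a -> W u -> W (a *: u)) ->
  (forall u v, 0 <= u -> u <= v -> W v -> W u) ->
  exists g : dual E,
    (forall w y, W w -> 0 <= w -> w <= y -> f w <= g y) /\
    (forall (C : R) y, 0 <= y ->
      (forall w, W w -> 0 <= w -> w <= y -> f w <= C) -> g y <= C).
Proof.
move=> f0 W0 WD WZ Wle.
pose S y : set R := [set f w | w in [set w | [/\ W w, 0 <= w & w <= y]]].
pose F y : R := sup (S y).
have Ssup y : 0 <= y -> has_sup (S y).
  move=> y0; split; first by exists (f 0), 0.
  by exists (f y) => _ [w [_ _ wy] <-]; exact: pos_dual_mono.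
have F1 w y : W w -> 0 <= w -> w <= y -> f w <= F y.
  move=> Ww w0 wy; apply: ub_le_sup; last by exists w.
  by case: (Ssup y (le_trans w0 wy)).
have F2 (C : R) y : 0 <= y ->
    (forall w, W w -> 0 <= w -> w <= y -> f w <= C) -> F y <= C.
  move=> y0 h; apply: ge_sup; first by case: (Ssup y y0).
  by move=> _ [w [Ww w0 wy] <-]; exact: h.
have F0 y : 0 <= y -> 0 <= F y.
  by move=> y0; have := F1 0 y W0 (lexx _) y0; rewrite linear0.
have FZ' (a : R) y : 0 < a -> 0 <= y -> F (a *: y) <= a * F y.
  move=> a0 y0; apply: F2 => [|w Ww w0 wy]; first by rewrite bl_scale_ge0// ltW.
  have ia0 : 0 <= a^-1 by rewrite invr_ge0 ltW.
  rewrite -ler_pdivrMl//.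
  rewrite -[_ * f w]/(a^-1 *: (f w : R^o)) -linearZ; apply: F1.
  - exact: WZ.
  - exact: bl_scale_ge0.
  - have := bl_leZ2l ia0 wy.
    by rewrite scalerA mulVf ?gt_eqF// scale1r.
have [|a y a0 y0|y y0|g gF] := @cone_extension R E F `|f|.
- move=> u v u0 v0; apply/le_anti/andP; split.
    apply: F2 => [|w Ww w0 wuv]; first exact: bl_addr_ge0.
    have [t /andP[t0 tu] /andP[wt0 wtv]] := riesz_decomposition u0 v0 w0 wuv.
    rewrite -(subrKC t w) linearD lerD// F1//.
      by apply: Wle Ww => //; rewrite -bl_subr_ge0.
    by apply: Wle Ww => //; rewrite bl_lerBlDr -[X in X <= _]addr0 bl_lerD2l.
  rewrite -lerBrDr; apply: (F2) => // s Ws s0 su.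
  rewrite lerBrDl -lerBrDr; apply: F2 => // t Wt t0 tv.
  rewrite lerBrDr -linearD; apply: F1; [exact: WD|exact: bl_addr_ge0|].
  by rewrite addrC bl_lerD.
- move: a0; rewrite le_eqVlt => /orP[/eqP<-|a0].
    rewrite scale0r mul0r; apply/le_anti; rewrite F0// andbT.
    apply: F2 => // w _ w0 w0'.
    by rewrite (_ : w = 0) ?linear0//; apply/le_anti; rewrite w0 w0'.
  apply/le_anti; rewrite FZ'//=.
  have ia0 : 0 < a^-1 by rewrite invr_gt0.
  have := FZ' _ (a *: y) ia0 (bl_scale_ge0 (ltW a0) y0).
  by rewrite scalerA mulVf ?gt_eqF// scale1r ler_pdivlMl.
- rewrite ger0_norm ?F0//; apply: F2 => // w _ w0 wy.
  rewrite (le_trans (ler_norm _))// (le_trans (le_dual_norm _ _))//.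
  by rewrite ler_wpM2l// bl_ge0_norm_le.
exists g; split=> [w y Ww w0 wy|C y y0 h]; rewrite gF//; last exact: F2.
  exact: F1.
exact: le_trans wy.
Qed.

(** For positive [x], this is the positive cone of the ideal generated by the [x i] with [i] in
    [D]. *)
Definition ideal_cone x (D : set nat) : set E :=
  [set w | 0 <= w /\ exists (s : seq nat) (c : R),
    [/\ {in s, forall i, D i}, 0 <= c & w <= c *: \sum_(i <- s) x i]].

(** At a generator the supremum is attained by the generator itself. If [v] is disjoint from all
    generators, an element of the cone below [v] is dominated by a multiple of a sum disjoint from
    [v], so it is zero. *)
Lemma ideal_restriction_seq f x (D : set nat) : 0 <= f -> positive_seq x ->
  exists g : dual E,
    [/\ forall w y, ideal_cone x D w -> w <= y -> f w <= g y,
      forall (C : R) y, 0 <= y ->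
        (forall w, ideal_cone x D w -> w <= y -> f w <= C) -> g y <= C,
      forall i, D i -> g (x i) = f (x i) &
      forall v, 0 <= v -> (forall i, D i -> Order.meet v (x i) = 0) -> g v = 0].
Proof.
move=> f0 x0.
have sum0 (s : seq nat) : 0 <= \sum_(i <- s) x i.
  by apply: (big_ind (fun z : E => 0 <= z)) => // *; exact: bl_addr_ge0.
have [||a u a0|u v u0 uv|g [g1 g2]] :=
  @ideal_restriction f (ideal_cone x D) f0 _.
- by split=> //; exists [::], 0; rewrite scale0r.
- move=> u v [u0 [s [c [sD c0 us]]]] [v0 [t [d [tD d0 vt]]]].
  split; first exact: bl_addr_ge0.
  exists (s ++ t), (c + d); split.
  + by move=> i; rewrite mem_cat => /orP[/sD|/tD].
  + exact: addr_ge0.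
  + rewrite big_cat /= scalerDl !scalerDr.
    rewrite bl_lerD// (le_trans us, le_trans vt)//.
      by rewrite -[X in X <= _]addr0 bl_lerD2l bl_scale_ge0.
    by rewrite -[X in X <= _]add0r bl_lerD2r bl_scale_ge0.
- move=> [u0 [s [c [sD c0 us]]]]; split; first exact: bl_scale_ge0.
  exists s, (a * c); split => //; first exact: mulr_ge0.
  by rewrite -scalerA bl_leZ2l.
- move=> [v0 [s [c [sD c0 us]]]]; split=> //.
  by exists s, c; split => //; exact: le_trans us.
exists g; split=> [w y Ww wy|C y y0 h|i Di|v v0 vx].
- by apply: g1 => //; case: Ww.
- by apply: g2 => // w Ww _; exact: h.
- apply/le_anti/andP; split; last first.
    apply: g1 => //; split => //; exists [:: i], 1.
    by split=> // [j|]; rewrite ?inE ?big_seq1 ?scale1r// => /eqP ->.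
  by apply: g2 => // w _ _; exact: pos_dual_mono.
- apply/le_anti/andP; split.
    apply: g2 => // w [w0 [s [c [sD c0 ws]]]] _ wv.
    rewrite (@le_disjoint_scale_eq0 _ _ v (\sum_(i <- s) x i) w c) ?linear0//.
    by apply: meet_sum_eq0 => // i /sD; exact: vx.
  rewrite -(linear0 f); apply: g1 => //; split=> //.
  by exists [::], 0; rewrite scale0r.
Qed.

Lemma dual_lposBneg f u : f u = lpos f u - lneg f u.
Proof. by rewrite {1}(lposBneg f). Qed.

Lemma weakly_null_pos x :
  (forall f, 0 <= f -> f (x n) @[n --> \oo] --> (0 : R)) -> weakly_null x.
Proof.
move=> h f; rewrite (_ : (fun n => f (x n)) =
    (fun n => lpos f (x n) - lneg f (x n))); last first.
  by apply/funext => n; exact: dual_lposBneg.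
by rewrite -[0 : R]subr0; apply: cvgB; apply: h; [exact: lpos_ge0|exact: lneg_ge0].
Qed.

Lemma disjoint_pos x : positive_seq x -> disjoint_seq x ->
  forall n k, n != k -> Order.meet (x n) (x k) = 0.
Proof. by move=> x0 dx n k /dx; rewrite !ge0_labs. Qed.

Lemma disjoint_bounded_weakly_null x : order_continuous_norm (dual E) ->
  positive_seq x -> disjoint_seq x -> norm_bounded x -> weakly_null x.
Proof.
move=> ocn x0 /(disjoint_pos x0) dx [C hC]; apply: weakly_null_pos => f f0.
have [G [G1 G2 Gf _]] := ideal_restriction_seq setT f0 x0.
have /choice[g hg] := fun n : nat =>
  ideal_restriction_seq [set i | (i < n)%N] f0 x0.
have gG n : g n <= G.
  apply/dual_leP => y y0; have [_ g2 _ _] := hg n.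
  apply: g2 => // w [w0 [s [c [_ c0 ws]]]]; apply: G1; split => //.
  by exists s, c.
have dir : directed (fun i j : nat => (i <= j)%N).
  split=> [|//|i j k|i j]; [exact: (inhabits 0%N)|exact: leq_trans|].
  by exists (maxn i j); rewrite leq_maxl leq_maxr.
have dec : decreases_to_0 (fun i j : nat => (i <= j)%N) (fun n => G - g n).
  split=> [i j ij|i|z hz].
  + rewrite bl_lerD2l bl_lerN2; apply/dual_leP => y y0.
    have [_ g2 _ _] := hg i; have [g1 _ _ _] := hg j.
    apply: g2 => // w [w0 [s [c [sD c0 ws]]]]; apply: g1; split=> //.
    by exists s, c; split=> // k /sD /= /leq_trans; exact.
  + by rewrite bl_subr_ge0.
  + apply/dual_leP => y y0; have -> : (0 : dual E) y = 0 by [].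
    apply/ler_addgt0Pr => e e0; rewrite add0r.
    apply: contrapT => /negP; rewrite -ltNge => ez.
    (* An element [w] of the full cone involves finitely many generators, so it lies in the cone of
       some [g n]. Then [f w <= g n y <= G y - z y], and [z y > e] would push the supremum [G y]
       down by [e]. *)
    have : G y <= G y - e.
      apply: G2 => // w [w0 [s [c [_ c0 ws]]]] wy.
      pose n := (\max_(i <- s) i).+1.
      have [g1 _ _ _] := hg n.
      have : f w <= g n y.
        apply: g1 => //; split=> //; exists s, c; split=> // i si.
        by rewrite /= ltnS; exact: (@leq_bigmax_seq _ s xpredT id).
      have /dual_leP/(_ y y0) := hz n; rewrite dualBE.
      by move: ez; clear; lra.
    by rewrite lerDl oppr_ge0 leNgt e0.
apply/cvgrPdist_le => e e0.
have C0 : 0 <= C by rewrite (le_trans _ (hC 0%N)).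
have C1 : 0 < 1 + C by rewrite ltr_pwDl.
have [i0 hi] := ocn _ _ _ dir dec _ (divr_gt0 e0 C1).
exists i0 => // n /= /hi hn; rewrite sub0r normrN.
(* [G] agrees with [f] at [x n], while [g n] vanishes there because [x n] is disjoint from all
   generators of index below [n]. *)
have -> : f (x n) = (G - g n) (x n).
  have [_ _ _ gx] := hg n; rewrite dualBE Gf// gx ?subr0// => i /= ni.
  by rewrite dx// gt_eqF.
rewrite (le_trans (le_dual_norm _ _))// (le_trans (ler_pM _ _ (ltW hn) (hC n)))//.
by rewrite mulrAC ler_pdivrMr// ler_wpM2l ?(ltW e0)// lerDr.
Qed.

(** Each [lneg (x n)] is disjoint from every [lpos (x i)], so the restricted functional [g] ignores
    negative parts: [f (lpos (x n)) = g (x n)]. *)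
Lemma disjoint_weakly_null_lpos x : disjoint_seq x -> weakly_null x ->
  weakly_null (fun n => lpos (x n)).
Proof.
move=> dx wx; apply: weakly_null_pos => f f0.
have x0 : positive_seq (fun n => lpos (x n)) by move=> n; exact: lpos_ge0.
have [g [_ _ gf gx]] := ideal_restriction_seq setT f0 x0.
rewrite (_ : (fun n => f (lpos (x n))) = (fun n => g (x n))); first exact: wx.
apply/funext => n; rewrite {2}(lposBneg (x n)) linearB /= gf// (gx (lneg _)) ?subr0//.
  exact: lneg_ge0.
move=> i _; have [->|ni] := eqVneq n i; first by rewrite meetC meet_lpos_lneg.
apply/le_anti; rewrite lexI lneg_ge0 lpos_ge0 !andbT -(dx _ _ ni).
by rewrite leI2// ?lneg_le_labs ?lpos_le_labs.
Qed.

End IdealRestriction.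

(** * Disjointification and almost order boundedness of balls *)

Section Disjointification.
Context {R : realType}.

Lemma dyadic_majorant (E : banachLatticeType R) (y : nat -> E) :
  positive_seq y -> (forall n, `|y n| <= 1) ->
  exists s : E, 0 <= s /\ forall n, 2^-1 ^+ n *: y n <= s.
Proof.
move=> y0 y1.
have [[e ye]|ny] := pselect (exists k, y k != 0); last first.
  exists 0; split=> // n; suff -> : y n = 0 by rewrite scaler0.
  by apply/eqP; apply: contrapT => /negP yn; apply: ny; exists n.
(* Vanishing terms are replaced by a fixed nonzero one, so that every term can be normalised before
   the series is summed. *)
pose k n := if y n == 0 then e else n.
have yk n : y (k n) != 0 by rewrite /k; case: (eqVneq (y n) 0).
have [n|n|s hs] := @bl_dyadic_series R E (fun n => `|y (k n)|^-1 *: y (k n)).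
- by rewrite bl_scale_ge0// invr_ge0.
- by rewrite normrZ normfV normr_id mulVf// normr_eq0.
have half0 n : 0 <= 2^-1 ^+ n :> R by rewrite exprn_ge0// invr_ge0.
have ys n : 2^-1 ^+ n *: y n <= s.
  apply: le_trans (hs n); rewrite bl_leZ2l//.
  rewrite -bl_subr_ge0 /k; case: (eqVneq (y n) 0) => [->|yn].
    by rewrite subr0 bl_scale_ge0// invr_ge0.
  rewrite -[X in _ - X]scale1r -scalerBl bl_scale_ge0// subr_ge0.
  by rewrite invf_ge1// normr_gt0.
exists s; split => //; apply: le_trans (ys 0%N).
by rewrite bl_scale_ge0.
Qed.

(** For [m < n] and [d = y m - 2^-m s], the term of index [m] is at most [lpos d]. The term of index
    [n] is at most [4^n lneg d], because [y n <= 2^n s <= 4^n 2^-m s] and [y m <= Y n]. The two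
    parts of [d] are disjoint. *)
Lemma disjointification (E : banachLatticeType R) (y Y : nat -> E) (s : E) :
  positive_seq Y -> (forall m n, (m < n)%N -> y m <= Y n) ->
  0 <= s -> (forall n, 2^-1 ^+ n *: y n <= s) ->
  disjoint_seq (fun n => lpos (y n - 4 ^+ n *: Y n - 2^-1 ^+ n *: s)).
Proof.
move=> Y0 yY s0 ys.
have p2 n : 0 <= 2^-1 ^+ n :> R by rewrite exprn_ge0// invr_ge0.
have p4 n : 0 <= 4 ^+ n :> R by rewrite exprn_ge0.
pose z n := lpos (y n - 4 ^+ n *: Y n - 2^-1 ^+ n *: s).
have main m n : (m < n)%N -> Order.meet (z m) (z n) = 0.
  move=> mn; pose d := y m - 2^-1 ^+ m *: s.
  have zm : z m <= lpos d.
    apply: lpos_mono; rewrite bl_lerD2r bl_lerBlDr -[X in X <= _]addr0.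
    by rewrite bl_lerD2l bl_scale_ge0.
  have zn : z n <= 4 ^+ n *: lneg d.
    apply: lpos_le; first by rewrite bl_scale_ge0 ?lneg_ge0.
    rewrite (@le_trans _ _ (4 ^+ n *: - d)) ?bl_leZ2l ?leUl//.
    rewrite opprB scalerBr -addrA bl_lerD//; last first.
      rewrite -opprD bl_lerN2 (le_trans (bl_leZ2l (p4 n) (yY _ _ mn)))//.
      by rewrite -[X in X <= _]addr0 bl_lerD2l bl_scale_ge0.
    rewrite (@le_trans _ _ (2 ^+ n *: s))//.
      have := bl_leZ2l (exprn_ge0 n (ler0n R 2)) (ys n).
      by rewrite scalerA -exprMn mulfV// expr1n scale1r.
    rewrite scalerA -bl_subr_ge0 -scalerBl bl_scale_ge0// subr_ge0.
    rewrite exprVn ler_pdivlMr ?exprn_gt0// (_ : 4 = 2 * 2 :> R); last by lra.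
    by rewrite exprMn ler_wpM2l ?exprn_ge0// ler_weXn2l ?(ltnW mn)// ler1n.
  apply: (le_disjoint_scale_eq0 (lpos_ge0 d) (lneg_ge0 d) (meet_lpos_lneg d)
    (p4 n)).
  - by rewrite lexI !lpos_ge0.
  - exact: le_trans (leIl _ _) zm.
  - exact: le_trans (leIr _ _) zn.
move=> n k; rewrite !ge0_labs ?lpos_ge0//.
by case: ltngtP => // [/main//|/main]; rewrite meetC.
Qed.

(* [q] stands either for a positive bilinear form or for
   [fun _ y => f y] with [f] a positive functional. *)
Lemma ball_almost_order_bounded (E1 E2 : banachLatticeType R)
  (q : E1 -> E2 -> R) :
  (forall (x x' : E1) (y y' : E2), 0 <= x -> x <= x' -> 0 <= y -> y <= y' ->
    q x y <= q x' y') ->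
  (forall (s : E1) (t : E2), 0 <= s -> 0 <= t ->
    exists K : R, forall (c : R) (x : E1) (y : E2),
    0 <= c -> c <= 1 -> 0 <= x -> 0 <= y -> `|x| <= 1 -> `|y| <= 1 ->
    q (x + c *: s) (y + c *: t) <= q x y + c * K) ->
  (forall x y, positive_seq x -> disjoint_seq x -> norm_bounded x ->
    positive_seq y -> disjoint_seq y -> norm_bounded y ->
    q (x n) (y n) @[n --> \oo] --> (0 : R)) ->
  forall e : R, 0 < e -> exists (x0 : E1) (y0 : E2),
    [/\ 0 <= x0, 0 <= y0 & forall (x : E1) (y : E2),
      0 <= x -> 0 <= y -> `|x| <= 1 -> `|y| <= 1 ->
      q (lpos (x - x0)) (lpos (y - y0)) <= e].
Proof.
move=> q_mono q_pert q_null e e0; apply: contrapT => nex.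
(* To each positive pair [p], [h] assigns a pair in the unit balls violating the desired bound at
   [p]. The positivity premises make the choice total, and non-positive pairs satisfy them
   vacuously. *)
have /choice[h hP] : forall p : E1 * E2, exists r : E1 * E2,
    0 <= p.1 -> 0 <= p.2 ->
    [/\ 0 <= r.1, 0 <= r.2, `|r.1| <= 1, `|r.2| <= 1
      & e < q (lpos (r.1 - p.1)) (lpos (r.2 - p.2))].
  move=> [x0 y0]; apply: contrapT => nr; apply: nex; exists x0, y0.
  split=> [||x y x0' y0' x1 y1].
  - by apply: contrapT => H; apply: nr; exists (0, 0) => /= /H.
  - by apply: contrapT => H; apply: nr; exists (0, 0) => /= _ /H.
  - by rewrite leNgt; apply/negP => H; apply: nr; exists (x, y).
pose next n (p : E1 * E2) := h (4 ^+ n *: p.1, 4 ^+ n *: p.2).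
(* [S n] is the sum of [r 0], ..., [r (n-1)], and [r n] violates the bound at [4^n S n]. Thus [S n]
   dominates all earlier [r m], as disjointification requires. *)
pose S := fix S n : E1 * E2 :=
  if n is m.+1 then S m + next m (S m) else (0, 0).
pose r n := next n (S n).
have p4 n : 0 <= 4 ^+ n :> R by rewrite exprn_ge0.
have p2 n : 0 <= 2^-1 ^+ n :> R by rewrite exprn_ge0// invr_ge0.
have S0 n : 0 <= (S n).1 /\ 0 <= (S n).2.
  elim: n => [|n [IH1 IH2]] //=.
  have [||h1 h2 _ _ _] := hP (4 ^+ n *: (S n).1, 4 ^+ n *: (S n).2);
    rewrite ?bl_scale_ge0//.
  by split; exact: bl_addr_ge0.
have rP n : [/\ 0 <= (r n).1, 0 <= (r n).2, `|(r n).1| <= 1, `|(r n).2| <= 1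
    & e < q (lpos ((r n).1 - 4 ^+ n *: (S n).1))
            (lpos ((r n).2 - 4 ^+ n *: (S n).2))].
  by have [S1 S2] := S0 n; apply: hP; exact: bl_scale_ge0.
have rS m n : (m < n)%N -> (r m).1 <= (S n).1 /\ (r m).2 <= (S n).2.
  elim: n => // n IH; rewrite ltnS leq_eqVlt => /predU1P[->|/IH[IH1 IH2]] /=.
    have [S1 S2] := S0 n.
    by split; rewrite -[X in X <= _]add0r bl_lerD2r.
  have [r1 r2 _ _ _] := rP n.
  by split; rewrite -[X in X <= _]addr0 bl_lerD.
have [|n|s [s0 rs]] := @dyadic_majorant E1 (fun n => (r n).1).
- by move=> n; case: (rP n).
- by case: (rP n).
have [|n|t [t0 rt]] := @dyadic_majorant E2 (fun n => (r n).2).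
- by move=> n; case: (rP n).
- by case: (rP n).
pose x n := lpos ((r n).1 - 4 ^+ n *: (S n).1 - 2^-1 ^+ n *: s).
pose y n := lpos ((r n).2 - 4 ^+ n *: (S n).2 - 2^-1 ^+ n *: t).
have x1 n : `|x n| <= 1.
  have [r1 _ rn _ _] := rP n; apply: le_trans rn.
  rewrite bl_ge0_norm_le ?lpos_ge0// /x -addrA -opprD lposB_le//.
  by rewrite bl_addr_ge0 ?bl_scale_ge0//; case: (S0 n).
have y1 n : `|y n| <= 1.
  have [_ r1 _ rn _] := rP n; apply: le_trans rn.
  rewrite bl_ge0_norm_le ?lpos_ge0// /y -addrA -opprD lposB_le//.
  by rewrite bl_addr_ge0 ?bl_scale_ge0//; case: (S0 n).
have lpos_split (E : banachLatticeType R) (a b : E) : 0 <= b ->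
    lpos a <= lpos (a - b) + b.
  move=> b0; rewrite leUx bl_addr_ge0 ?lpos_ge0// andbT.
  by rewrite -bl_lerBlDr leUl.
have [K hK] := q_pert s t s0 t0.
(* Subtracting the extra [2^-n s] and [2^-n t], which produce disjointness, costs only [2^-n K]; the
   values of [q] along disjoint bounded sequences therefore stay above [e] up to a null term. *)
have eq n : e < q (x n) (y n) + 2^-1 ^+ n * K.
  have [_ _ _ _ er] := rP n; apply: lt_le_trans er _.
  apply: le_trans (hK _ _ _ (p2 n) _ _ _ _ _); rewrite ?lpos_ge0//; last first.
    by rewrite exprn_ile1// ?invr_ge0// invf_le1// ler1n.
  by apply: q_mono; rewrite ?lpos_ge0//; apply: lpos_split; exact: bl_scale_ge0.
have lim0 : q (x n) (y n) + 2^-1 ^+ n * K @[n --> \oo] --> (0 : R).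
  rewrite -[0 : R]addr0; apply: cvgD; last first.
    rewrite -(mul0r K); apply: cvgMr_tmp; apply: cvg_expr.
    by rewrite ger0_norm ?invr_ge0// invf_lt1// ltr1n.
  apply: q_null; rewrite /x /y; try by move=> n; exact: lpos_ge0.
  - apply: (disjointification (y := fun n => (r n).1) (Y := fun n => (S n).1)) => //.
      by move=> n; case: (S0 n).
    by move=> m n /rS[].
  - by exists 1.
  - apply: (disjointification (y := fun n => (r n).2) (Y := fun n => (S n).2)) => //.
      by move=> n; case: (S0 n).
    by move=> m n /rS[].
  - by exists 1.
have /cvgrPdist_lt/(_ _ e0)[n _ /(_ n (leqnn n))] := lim0.
rewrite /= sub0r normrN => /(le_lt_trans (ler_norm _)) /(lt_trans (eq n)).
by rewrite ltxx.
Qed.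

End Disjointification.

(** * Norm estimates for positive functionals; weak* null sequences *)

Section DualNormPositive.
Context {R : realType} {E : banachLatticeType R}.
Implicit Types (f g : dual E) (x y : E).

Lemma le_homogeneous g (e : R) :
  (forall x, 0 <= x -> `|x| <= 1 -> g x <= e) ->
  forall x, 0 <= x -> g x <= e * `|x|.
Proof.
move=> ge x x0; have [->|xn0] := eqVneq x 0.
  by rewrite linear0 normr0 mulr0.
have nx0 : 0 < `|x| by rewrite normr_gt0.
rewrite -ler_pdivrMr// mulrC -[_ * g x]/(`|x|^-1 *: (g x : R^o)) -linearZ.
apply: ge; first by rewrite bl_scale_ge0// invr_ge0.
by rewrite normrZ normfV normr_id mulVf// gt_eqF.
Qed.

Lemma pos_dual_norm_le f (e : R) : 0 <= f -> 0 <= e ->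
  (forall x, 0 <= x -> `|x| <= 1 -> f x <= e) -> `|f| <= e.
Proof.
move=> f0 e0 fe; apply: dual_norm_le => // x.
apply: (@le_trans _ _ (f (labs x))).
  rewrite ler_norml (pos_dual_mono _ (le_labs x))// andbT lerNl.
  by rewrite -linearN (pos_dual_mono _ (leN_labs x)).
by rewrite (le_trans (le_homogeneous fe (labs_ge0 x)))// norm_labs.
Qed.

(** By the Riesz-Kantorovich formula, [lpos g] at [x >= 0] is the supremum of [g] over [[0, x]], and
    this interval stays in the ball containing [x]. *)
Lemma lpos_dual_norm_le g (e : R) : 0 <= e ->
  (forall x, 0 <= x -> `|x| <= 1 -> g x <= e) -> `|lpos g| <= e.
Proof.
move=> e0 ge; apply: pos_dual_norm_le; rewrite ?lpos_ge0// => x x0 x1.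
have -> : lpos g x = rk_sup g 0 x by exact: dual_join_fun_ge0.
apply: rk_sup_le => // y y0 yx; rewrite [X in _ + X](_ : _ = 0)// addr0.
by rewrite ge// (le_trans _ x1)// bl_ge0_norm_le.
Qed.

Lemma le_pos_dual_lpos f x : 0 <= f -> f x <= `|f| * `|lpos x|.
Proof.
move=> f0; rewrite (le_trans (pos_dual_mono f0 (leUl x 0)))//.
by rewrite (le_trans (ler_norm _))// le_dual_norm.
Qed.

(** One-variable instance of the disjointification argument: [q] ignores its first argument, and
    disjoint bounded sequences are weakly null. *)
Lemma ocn_dual_almost_order_bounded f : order_continuous_norm (dual E) ->
  0 <= f -> forall e : R, 0 < e -> exists2 y0, 0 <= y0 &
    forall y, 0 <= y -> `|y| <= 1 -> f (lpos (y - y0)) <= e.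
Proof.
move=> ocn f0 e e0.
have [|||x0 [y0 [_ y00 h]]] :=
  @ball_almost_order_bounded R E E (fun _ y => f y) _ _ _ e e0.
- by move=> x x' y y' _ _ _ ?; exact: pos_dual_mono.
- move=> s t _ _; exists (f t) => c x y *.
  by rewrite linearD linearZ.
- by move=> x y _ _ _ y0 dy yb; exact: disjoint_bounded_weakly_null.
exists y0 => // y yy0 y1; apply: (h 0 y) => //; by rewrite normr0.
Qed.

(** Uniform boundedness principle: a convergent scalar sequence is bounded, so the functionals are
    pointwise bounded on the complete space [X]. *)
Lemma weak_star_null_bounded (X : completeNormedModType R) (f : nat -> dual X) :
  weak_star_null f -> norm_bounded f.
Proof.
move=> f0.
have [| |M hM] := @Banach_Steinhauss R X R^o (range (fun n => f n : X -> R^o)) _ _ 1.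
- move=> _ [n _ <-]; split; last exact: dual_linear.
  move=> r; exists (`|f n| * r) => x xr.
  by rewrite (le_trans (le_dual_norm _ _))// ler_wpM2l.
- move=> x; have [M [_ hM]] := cvg_seq_bounded (cvgP _ (f0 x)).
  by exists (M + 1) => _ [n _ <-]; apply: hM => //; rewrite ltrDl.
exists `|M| => n; rewrite dual_normE /opnorm; apply: ge_sup.
  by case: (opnorm_ball_sup (f n)).
move=> _ [x /= x1 <-]; apply: le_trans (ler_norm M).
by apply: hM x1; exists n.
Qed.

Lemma weakly_null_weak_star (X : normedModType R) (f : nat -> dual X) :
  weakly_null f -> weak_star_null f.
Proof.
move=> wf x.
have ev : (fun g : dual X => g x : R^o) \in dual_pred (dual X).
  apply: (@bounded_linear_dual_pred _ _ _ `|x|) => // g.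
  by rewrite mulrC le_dual_norm.
exact: wf (Dual ev).
Qed.

End DualNormPositive.

(** * Exchange of the two variables *)

Section FlipForm.
Context {R : realType} {E1 E2 : banachLatticeType R}.
Variable A : {bilinear E1 -> E2 -> R^o}.

Definition flip_form_fun (y : E2) (x : E1) : R^o := A x y.

Lemma flip_form_bilinear :
  bilinear_for (GRing.Scale.Law.clone _ _ *:%R _)
    (GRing.Scale.Law.clone _ _ *:%R _) flip_form_fun.
Proof.
by split=> [x|y] a u v; rewrite /flip_form_fun ?linearPl ?linearPr.
Qed.

HB.instance Definition _ :=
  bilinear_isBilinear.Build R E2 E1 R^o _ _ flip_form_fun flip_form_bilinear.

Definition flip_form : {bilinear E2 -> E1 -> R^o} := flip_form_fun.

End FlipForm.

(** * Estimates for positive bilinear forms *)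

Section PositiveForms.
Context {R : realType}.
Implicit Types E F : banachLatticeType R.

(** The form in which the almost Dunford-Pettis property enters the estimates: norm boundedness
    replaces weak nullity, and the condition is stable under [flip_form]. *)
Definition disjoint_null E F (A : {bilinear E -> F -> R^o}) :=
  forall x y, positive_seq x -> disjoint_seq x -> norm_bounded x ->
    positive_seq y -> disjoint_seq y -> norm_bounded y ->
    A (x n) (y n) @[n --> \oo] --> (0 : R).

Lemma flip_disjoint_null E F (A : {bilinear E -> F -> R^o}) :
  disjoint_null A -> disjoint_null (flip_form A).
Proof. by move=> nA x y x0 dx bx y0 dy yb; exact: nA. Qed.

Lemma flip_positive_form E F (A : {bilinear E -> F -> R^o}) :
  positive_form A -> positive_form (flip_form A).
Proof. by move=> A0 x y x0 y0; exact: A0. Qed.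

Lemma adp_disjoint_null E F (A : {bilinear E -> F -> R^o}) :
  order_continuous_norm (dual E) -> order_continuous_norm (dual F) ->
  almost_dunford_pettis A -> disjoint_null A.
Proof.
move=> ocnE ocnF dpA x y x0 dx bx y0 dy yb.
by apply: dpA => //; exact: disjoint_bounded_weakly_null.
Qed.

Lemma positive_form_mono E F (A : {bilinear E -> F -> R^o})
    (x x' : E) (y y' : F) :
  positive_form A -> 0 <= x -> x <= x' -> 0 <= y -> y <= y' ->
  (A x y : R) <= A x' y'.
Proof.
move=> A0 x0 xx' y0 yy'; apply: (@le_trans _ _ (A x' y : R)).
  by rewrite -subr_ge0 -linearBl A0// bl_subr_ge0.
by rewrite -subr_ge0 -linearBr A0// ?bl_subr_ge0// (le_trans x0).
Qed.

Lemma form_almost_order_bounded E F (A : {bilinear E -> F -> R^o}) (e : R) :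
  positive_form A -> disjoint_null A -> 0 < e ->
  exists (x0 : E) (y0 : F), [/\ 0 <= x0, 0 <= y0 &
    forall (x : E) (y : F), 0 <= x -> 0 <= y -> `|x| <= 1 -> `|y| <= 1 ->
      (A (lpos (x - x0)) (lpos (y - y0)) : R) <= e].
Proof.
move=> A0 nA e0; apply: (ball_almost_order_bounded (q := fun x y => A x y)) => //.
  by move=> x x' y y'; exact: positive_form_mono.
move=> s t s0 t0; have [C C0 hC] := positive_form_bounded A0.
(* The constant comes from expanding [A] by bilinearity on the unit balls, with [c^2 <= c] for the
   last term. *)
exists (C * `|t| + C * `|s| + A s t) => c x y c0 c1 x0 y0 x1 y1.
have -> : A (x + c *: s) (y + c *: t) =
    A x y + c * A x t + (c * A s y + c * (c * A s t)) :> R.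
  by rewrite linearDl !linearDr !linearZl !linearZr.
have At : (A x t : R) <= C * `|t|.
  rewrite (le_trans (ler_norm _))// (le_trans (hC _ _))// ler_wpM2r//.
  by rewrite -[leRHS]mulr1 ler_wpM2l.
have As : (A s y : R) <= C * `|s|.
  by rewrite (le_trans (ler_norm _))// (le_trans (hC _ _))// ler_piMr// mulr_ge0.
have cst : c * (c * A s t) <= c * A s t :> R.
  by rewrite ler_wpM2l// ler_piMl// A0.
move: (ler_wpM2l c0 At) (ler_wpM2l c0 As) cst.
move: (A x y : R) (A x t : R) (A s y : R) (A s t : R) => a b d f.
by move: (C * _) (C * _) => k l; lra.
Qed.

(** Cut [x] at [x1]. Against the part of [x] below [x1], cut [y] at [y2], where the functional
    [A(x1, .)] leaves at most [e/2]. Against [lpos (x - x1)], cut [y] at [y1], where the joint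
    estimate leaves at most [e/2]. The remaining two terms are at most [A x y2] and [A x y1]. *)
Lemma form_le_translate E F (A : {bilinear E -> F -> R^o}) (e : R) :
  order_continuous_norm (dual F) -> positive_form A -> disjoint_null A ->
  0 < e -> exists2 y0 : F, 0 <= y0 &
    forall (x : E) (y : F), 0 <= x -> 0 <= y -> `|x| <= 1 -> `|y| <= 1 ->
      (A x y : R) <= A x y0 + e.
Proof.
move=> ocn A0 nA e0; have e2 : 0 < e / 2 by rewrite divr_gt0.
have [x1 [y1 [x10 y10 h1]]] := form_almost_order_bounded A0 nA e2.
have [|y2 y20 h2] := @ocn_dual_almost_order_bounded _ _
  (section_r (positive_form_continuous A0) x1) ocn _ _ e2.
  by apply/dual_leP => y y0; exact: A0.
exists (y1 + y2); first exact: bl_addr_ge0.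
move=> x y x0 y0 nx ny.
have Ax (z : F) : A x z = A (x - lpos (x - x1)) z + A (lpos (x - x1)) z.
  by rewrite -linearDl subrK.
have Ay z (u : F) : A z y = A z (y - lpos (y - u)) + A z (lpos (y - u)).
  by rewrite -linearDr subrK.
have x1x : 0 <= x - lpos (x - x1) by rewrite bl_subr_ge0 lposB_le.
have yB u : 0 <= u -> 0 <= y - lpos (y - u).
  by move=> u0; rewrite bl_subr_ge0 lposB_le.
have yu u : y - lpos (y - u) <= u by exact: subr_lposB_le.
have xx : x - lpos (x - x1) <= x.
  by rewrite bl_lerBlDr -[X in X <= _]addr0 bl_lerD2l lpos_ge0.
have a1 := h1 _ _ x0 y0 nx ny.
have a2 : A (x - lpos (x - x1)) (lpos (y - y2)) <= e / 2 :> R.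
  apply: le_trans (h2 _ y0 ny); apply: positive_form_mono => //.
    exact: subr_lposB_le.
  exact: lpos_ge0.
have a3 : A (x - lpos (x - x1)) (y - lpos (y - y2)) <= A x y2 :> R.
  by apply: positive_form_mono => //; exact: yB.
have a4 : A (lpos (x - x1)) (y - lpos (y - y1)) <= A x y1 :> R.
  apply: positive_form_mono; rewrite ?lpos_ge0 ?yB//; exact: lposB_le.
rewrite Ax (Ay _ y2) (Ay (lpos _) y1) [in leRHS]linearDr.
move: a1 a2 a3 a4.
move: (A _ _ : R) (A _ _ : R) (A _ _ : R) (A _ _ : R) (A _ _ : R) (A _ _ : R).
by move=> *; lra.
Qed.

(** * Transfer of the estimates to the bidual *)

Section Lift.
Variables (E F : banachLatticeType R) (A : {bilinear E -> F -> R^o}).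
Hypotheses (cA : continuous (fun p : E * F => A p.1 p.2)) (A0 : positive_form A).

Lemma section_l_ge0 (y : F) : 0 <= y -> 0 <= section_l cA y.
Proof. by move=> y0; apply/dual_leP => x x0; exact: A0. Qed.

Lemma section_r_ge0 (x : E) : 0 <= x -> 0 <= section_r cA x.
Proof. by move=> x0; apply/dual_leP => y y0; exact: A0. Qed.

Lemma lift_l_ge0 (x'' : dual (dual E)) : 0 <= x'' -> 0 <= lift_l cA x''.
Proof.
move=> x''0; apply/dual_leP => y y0.
exact: pos_dual_ge0 x''0 (section_l_ge0 y0).
Qed.

(** The hypothesis says that the positive part of [section_l cA y - section_l cA y0] has norm at
    most [e] for [y] in the positive unit ball; then apply the positive functional [x'']. *)
Lemma lift_l_norm_le (x'' : dual (dual E)) (y0 : F) (e : R) :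
  0 <= x'' -> 0 <= y0 -> 0 <= e ->
  (forall (x : E) (y : F), 0 <= x -> 0 <= y -> `|x| <= 1 -> `|y| <= 1 ->
     (A x y : R) <= A x y0 + e) ->
  `|lift_l cA x''| <= x'' (section_l cA y0) + e * `|x''|.
Proof.
move=> x''0 y00 e0 Ae; apply: pos_dual_norm_le.
- exact: lift_l_ge0.
- by rewrite addr_ge0 ?mulr_ge0// pos_dual_ge0 ?section_l_ge0.
move=> y yy0 y1; rewrite /= -(subrKC (section_l cA y0) (section_l cA y)).
rewrite linearD lerD2l (le_trans (le_pos_dual_lpos _ x''0))// mulrC ler_wpM2r//.
apply: lpos_dual_norm_le => // x x0 x1.
by rewrite dualBE /= lerBlDl Ae.
Qed.

(** On the positive unit ball the norm of [section_l cA y] is at most [A x0 y + e]. Hence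
    [lift_l cA x''] exceeds the multiple of [section_r cA x0] by the norm of [x''] only by a
    functional whose positive part is small, and [y''] is applied to this. *)
Lemma lift_l_apply_le (x'' : dual (dual E)) (y'' : dual (dual F))
    (x0 : E) (e : R) :
  0 <= x'' -> 0 <= y'' -> 0 <= x0 -> 0 <= e ->
  (forall (x : E) (y : F), 0 <= x -> 0 <= y -> `|x| <= 1 -> `|y| <= 1 ->
     (A x y : R) <= A x0 y + e) ->
  y'' (lift_l cA x'') <= `|x''| * (y'' (section_r cA x0) + e * `|y''|).
Proof.
move=> x''0 y''0 x00 e0 Ae.
rewrite -(subrKC (`|x''| *: section_r cA x0) (lift_l cA x'')).
rewrite linearD linearZ /= -[_ *: _]/(_ * _) mulrDr lerD2l.
rewrite (le_trans (le_pos_dual_lpos _ y''0))//.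
rewrite mulrA [leLHS]mulrC ler_wpM2r//.
apply: lpos_dual_norm_le => [|y y0 y1]; first exact: mulr_ge0.
rewrite dualBE dualZE /= lerBlDl -mulrDr.
rewrite (le_trans (ler_norm _))// (le_trans (le_dual_norm _ _))// ler_wpM2l//.
apply: pos_dual_norm_le; first exact: section_l_ge0.
  by rewrite addr_ge0// A0.
by move=> x x0' x1 /=; exact: Ae.
Qed.

End Lift.

(** * Limits along weak* null sequences *)

Lemma squeeze_null (u : nat -> R) (C : R) : 0 <= C -> (forall n, 0 <= u n) ->
  (forall e : R, 0 < e -> exists v : nat -> R,
    (v n @[n --> \oo] --> (0 : R)) /\ forall n, u n <= C * (v n + e * C)) ->
  u n @[n --> \oo] --> (0 : R).
Proof.
move=> C0 u0 h; apply/cvgrPdist_lt => e e0.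
have C1 : 0 < 1 + C by rewrite ltr_pwDl.
(* Once [v n < d (1 + C)], the bound is below [2 d (1 + C)^2 = e]; using [1 + C] keeps the divisor
   positive when [C = 0]. *)
pose d := e / (2 * (1 + C) ^+ 2).
have d0 : 0 < d by rewrite divr_gt0// mulr_gt0// exprn_gt0.
have [v [v0 uv]] := h _ d0.
have dC0 : 0 < d * (1 + C) by rewrite mulr_gt0.
have /cvgrPdist_lt/(_ _ dC0) := v0; apply: filterS => n.
rewrite !sub0r !normrN (ger0_norm (u0 n)) => /(le_lt_trans (ler_norm _)) vn.
apply: le_lt_trans (uv n) _.
have -> : e = (1 + C) * (d * (1 + C) + d * (1 + C)).
  by rewrite /d; field; rewrite gt_eqF.
have : v n + d * C < d * (1 + C) + d * (1 + C).
  by rewrite ltrD// ltr_pM2l// ltrDr.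
move=> /ltW /(ler_wpM2l C0) /le_lt_trans; apply.
by rewrite ltr_pM2r ?ltrDr// addr_gt0.
Qed.

Lemma lift_l_null E F (A : {bilinear E -> F -> R^o})
    (cA : continuous (fun p : E * F => A p.1 p.2))
    (x : nat -> dual (dual E)) (y : nat -> dual (dual F)) :
  order_continuous_norm (dual F) -> positive_form A -> disjoint_null A ->
  positive_seq x -> weak_star_null x -> positive_seq y -> norm_bounded y ->
  y n (lift_l cA (x n)) @[n --> \oo] --> (0 : R).
Proof.
move=> ocnF A0 nA x0 wx y0 [C hC]; have [D hD] := weak_star_null_bounded wx.
have C0 : 0 <= C by rewrite (le_trans _ (hC 0%N)).
have D0 : 0 <= D by rewrite (le_trans _ (hD 0%N)).
(* [C + D] bounds both sequences in norm, so one constant serves as the outer factor and in the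
   error term. *)
apply: (@squeeze_null _ (C + D)) => [|n|e e0]; first exact: addr_ge0.
  by rewrite pos_dual_ge0// lift_l_ge0.
have [y1 y10 hA] := form_le_translate ocnF A0 nA e0.
exists (fun n => x n (section_l cA y1)); split; first exact: wx.
move=> n; rewrite (le_trans (ler_norm _))// (le_trans (le_dual_norm _ _))//.
rewrite ler_pM//; first by rewrite (le_trans (hC n))// lerDl.
rewrite (le_trans (lift_l_norm_le cA A0 (x0 n) y10 (ltW e0) hA))// lerD2l.
by rewrite ler_wpM2l ?(ltW e0)// (le_trans (hD n))// lerDr.
Qed.

(** The weak* null functionals now act on the lift from outside, so the lift is compared with
    [section_r cA x1], where [x1] comes from the translation estimate for the flipped form. *)
Lemma lift_l_null_r E F (A : {bilinear E -> F -> R^o})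
    (cA : continuous (fun p : E * F => A p.1 p.2))
    (x : nat -> dual (dual E)) (y : nat -> dual (dual F)) :
  order_continuous_norm (dual E) -> positive_form A -> disjoint_null A ->
  positive_seq x -> norm_bounded x -> positive_seq y -> weak_star_null y ->
  y n (lift_l cA (x n)) @[n --> \oo] --> (0 : R).
Proof.
move=> ocnE A0 nA x0 [C hC] y0 wy; have [D hD] := weak_star_null_bounded wy.
have C0 : 0 <= C by rewrite (le_trans _ (hC 0%N)).
have D0 : 0 <= D by rewrite (le_trans _ (hD 0%N)).
apply: (@squeeze_null _ (C + D)) => [|n|e e0]; first exact: addr_ge0.
  by rewrite pos_dual_ge0// lift_l_ge0.
have [x1 x10 hA] := form_le_translate ocnE (flip_positive_form A0)
  (flip_disjoint_null nA) e0.
exists (fun n => y n (section_r cA x1)); split; first exact: wy.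
move=> n; have hA' (u : E) (v : F) :
    0 <= u -> 0 <= v -> `|u| <= 1 -> `|v| <= 1 ->
    (A u v : R) <= A x1 v + e by move=> *; exact: hA.
rewrite (le_trans (lift_l_apply_le cA A0 (x0 n) (y0 n) x10 (ltW e0) hA'))//.
rewrite ler_pM//; first by rewrite addr_ge0 ?mulr_ge0 ?(ltW e0)//
  pos_dual_ge0 ?section_r_ge0.
  by rewrite (le_trans (hC n))// lerDl.
by rewrite lerD2l ler_wpM2l ?(ltW e0)// (le_trans (hD n))// lerDr.
Qed.

(** [lift_r] of [A] is [lift_l] of the flipped form, so each choice of extension and of weak* null
    variable is covered by one of the two preceding limits. *)
Lemma wpl_aron_berner E F (A : {bilinear E -> F -> R^o})
    (cA : continuous (fun p : E * F => A p.1 p.2)) (rho : 'S_2) :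
  order_continuous_norm (dual E) -> order_continuous_norm (dual F) ->
  positive_form A -> disjoint_null A ->
  weakly_positively_limited (aron_berner cA rho).
Proof.
move=> ocnE ocnF A0 nA.
have cA' := positive_form_continuous (flip_positive_form A0).
have liftE (y : dual (dual F)) : lift_r cA y = lift_l cA' y.
  by apply: dualP => x /=; congr (y _); exact: dualP.
have A0' := flip_positive_form A0; have nA' := flip_disjoint_null nA.
have idE x y : rho == 1%g -> aron_berner cA rho x y = y (lift_l cA x).
  by rewrite -[aron_berner cA rho x y]/(aron_berner_fun cA rho x y)
    /aron_berner_fun => ->.
have thetaE x y : rho != 1%g -> aron_berner cA rho x y = x (lift_l cA' y).
  rewrite -[aron_berner cA rho x y]/(aron_berner_fun cA rho x y).
  by rewrite /aron_berner_fun => /negbTE ->; rewrite liftE.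
have null (x : nat -> dual (dual E)) (y : nat -> dual (dual F)) :
    y n (lift_l cA (x n)) @[n --> \oo] --> (0 : R) ->
    x n (lift_l cA' (y n)) @[n --> \oo] --> (0 : R) ->
    norm_null (fun n => aron_berner cA rho (x n) (y n)).
  move=> h1 h2; have [h|h] := boolP (rho == 1%g); rewrite /norm_null.
    rewrite (_ : (fun n => aron_berner _ _ _ _) =
      fun n => y n (lift_l cA (x n)))//.
    by apply/funext => n; exact: idE.
  rewrite (_ : (fun n => aron_berner _ _ _ _) =
    fun n => x n (lift_l cA' (y n)))//.
  by apply/funext => n; exact: thetaE.
split=> x y x0 hx y0 hy; apply: null.
- exact: (lift_l_null cA ocnF A0 nA x0 hx y0 hy).
- exact: (lift_l_null_r cA' ocnF A0' nA' y0 hy x0 hx).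
- exact: (lift_l_null_r cA ocnE A0 nA x0 hx y0 hy).
- exact: (lift_l_null cA' ocnE A0' nA' y0 hy x0 hx).
Qed.

(** Splitting both arguments into positive and negative parts gives four terms. All parts are
    positive and weakly null, hence weak* null and bounded. *)
Lemma wpl_almost_dunford_pettis (X1 X2 : banachLatticeType R)
    (G : completeNormedModType R) (B : {bilinear dual X1 -> dual X2 -> G}) :
  weakly_positively_limited B -> almost_dunford_pettis B.
Proof.
move=> [hB _] x y dx wx dy wy.
have wplus (X : banachLatticeType R) (f : nat -> dual X) :
    disjoint_seq f -> weakly_null f ->
    weak_star_null (fun n => lpos (f n)).
  by move=> df wf; apply: weakly_null_weak_star; exact: disjoint_weakly_null_lpos.
have wminus (X : banachLatticeType R) (f : nat -> dual X) :
    disjoint_seq f -> weakly_null f ->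
    weak_star_null (fun n => lneg (f n)).
  (* The negative part of [f n] is the positive part of [- f n], and negation preserves disjointness
     and weak nullity. *)
  move=> df wf; apply: (wplus _ (fun n => - f n)) => [n k nk|g].
    by rewrite !labsN; exact: df.
  rewrite (_ : (fun n => _) = (fun n => - g (f n))); last first.
    by apply/funext => n; rewrite linearN.
  by rewrite -oppr0; apply: cvgN; exact: wf.
rewrite /norm_null (_ : (fun n => B (x n) (y n)) = (fun n =>
  (B (lpos (x n)) (lpos (y n)) - B (lneg (x n)) (lpos (y n))) -
  (B (lpos (x n)) (lneg (y n)) - B (lneg (x n)) (lneg (y n))))); last first.
  apply/funext => n; rewrite {1}(lposBneg (x n)) {1}(lposBneg (y n)).
  by rewrite linearBr !linearBl.
have p0 (X : banachLatticeType R) (f : nat -> dual X) :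
    positive_seq (fun n => lpos (f n)).
  by move=> n; exact: lpos_ge0.
have n0 (X : banachLatticeType R) (f : nat -> dual X) :
    positive_seq (fun n => lneg (f n)).
  by move=> n; exact: lneg_ge0.
have null (f : nat -> dual X1) (g : nat -> dual X2) :
    positive_seq f -> weak_star_null f ->
    positive_seq g -> weak_star_null g -> norm_null (fun n => B (f n) (g n)).
  by move=> f0 wf g0 wg; apply: hB => //; exact: weak_star_null_bounded.
have := cvgB
  (cvgB (null _ _ (p0 _ x) (wplus _ x dx wx) (p0 _ y) (wplus _ y dy wy))
        (null _ _ (n0 _ x) (wminus _ x dx wx) (p0 _ y) (wplus _ y dy wy)))
  (cvgB (null _ _ (p0 _ x) (wplus _ x dx wx) (n0 _ y) (wminus _ y dy wy))
        (null _ _ (n0 _ x) (wminus _ x dx wx) (n0 _ y) (wminus _ y dy wy))).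
by rewrite !subr0; apply.
Qed.

End PositiveForms.

Theorem theorem3p7 (R : realType) (E1 E2 : banachLatticeType R)
  (ocn1 : order_continuous_norm (dual E1))
  (ocn2 : order_continuous_norm (dual E2))
  (A : {bilinear E1 -> E2 -> R^o})
  (A_pos : positive_form A) (A_dp : almost_dunford_pettis A) (rho : 'S_2) :
  weakly_positively_limited (aron_berner (positive_form_continuous A_pos) rho)
  /\ almost_dunford_pettis (aron_berner (positive_form_continuous A_pos) rho).
Proof.
have wpl : weakly_positively_limited
    (aron_berner (positive_form_continuous A_pos) rho).
  by apply: wpl_aron_berner => //; exact: adp_disjoint_null.
by split => //; exact: wpl_almost_dunford_pettis.
Qed.
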